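(* Consider the linear contextual bandit setting described in the context, with Assumptions (A1)–(A4). For each $t=1,\ldots,T$, let $\check\beta_t$ be any $\mathcal{H}_t$-measurable estimator satisfying $\|\check\beta_t-\beta\|_2\le b$ for some constant $b>0$. Assume that $\pi_i(t)>0$ for every $i$ and $t$, and that there exists $\gamma\in[1/(N+1),1/N)$ such that $\pi_{a_t}(t)>\gamma$ for all $t$. Given any $\delta\in(0,1)$, set $\lambda_t=4\sqrt2N\sqrt{t\log\frac{12t^2}{\delta}}$. Then with probability at least $1-\delta$, the estimator $\widehat\beta_t$ satisfies $$\|\widehat\beta_t-\beta\|_2\le\frac{C_{b,\sigma}}{\phi^2\sqrt t}\sqrt{\log\frac{12t^2}{\delta}}\quad\text{for all }t=1,\ldots,T,$$ where $C_{b,\sigma}$ is a constant depending only on $b$ and $\sigma$.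
   Context: Linear contextual bandit: there are $N$ arms and a horizon $T$. At each round $t$, contexts $X_i(t)\in\mathbb{R}^d$, $i=1,\ldots,N$, are observed; arm $i$ has a random reward $Y_i(t)$ with $\mathbb{E}[Y_i(t)\mid X_i(t)]=X_i(t)^T\beta$ for an unknown $\beta\in\mathbb{R}^d$. A (possibly randomized) policy chooses $a_t\in\{1,\ldots,N\}$ and only $Y_{a_t}(t)$ is observed. Let $\mathcal{H}_t=\bigcup_{\tau=1}^{t-1}\big[\{X_i(\tau)\}_{i=1}^N\cup\{a_\tau\}\cup\{Y_{a_\tau}(\tau)\}\big]\cup\{X_i(t)\}_{i=1}^N$ and $\pi_i(t)=\mathbb{P}(a_t=i\mid\mathcal{H}_t)$. Assumptions: (A1) $\|X_i(t)\|_2\le1$ for all $i,t$ and $\|\beta\|_2\le1$. (A2) For each $i,t$, $\eta_i(t):=Y_i(t)-X_i(t)^T\beta$ satisfies $\mathbb{E}[\eta_i(t)\mid\mathcal{H}_t]=0$ and $\mathbb{E}[\exp(\lambda\eta_i(t))\mid\mathcal{H}_t]\le\exp(\lambda^2\sigma^2/2)$ for all $\lambda\in\mathbb{R}$, for a fixed $\sigma\ge0$; moreover the distribution of $\eta_i(t)$ does not depend on $a_t$. (A3) The stacked vectors $(X_1(t),\ldots,X_N(t))\in\mathbb{R}^{dN}$, $t=1,\ldots,T$, are independent. (A4) There is $\phi^2>0$ with $\lambda_{\min}\big(\mathbb{E}[\frac1N\sum_{i=1}^N X_i(t)X_i(t)^T]\big)\ge\phi^2$ for each $t$. DR estimator: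 pseudo-rewards $Y^{DR}_i(t)=\big(1-\frac{\mathbb{I}(i=a_t)}{\pi_i(t)}\big)X_i(t)^T\check\beta_t+\frac{\mathbb{I}(i=a_t)}{\pi_i(t)}Y_{a_t}(t)$, and $$\widehat\beta_t=\Big(\sum_{\tau=1}^t\sum_{i=1}^N X_i(\tau)X_i(\tau)^T+\lambda_tI\Big)^{-1}\Big(\sum_{\tau=1}^t\sum_{i=1}^N X_i(\tau)Y^{DR}_i(\tau)\Big).$$ *)

(* Defs.v *)
From HB Require Import structures.
From mathcomp Require Import all_boot all_order all_algebra.
From mathcomp Require Import all_classical all_reals all_analysis.
Set Implicit Arguments. Unset Strict Implicit. Unset Printing Implicit Defensive.
Import Order.TTheory GRing.Theory Num.Theory.
Local Open Scope classical_set_scope.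
Local Open Scope ring_scope.

Section Defs.
Context {dT : measure_display} {Omega : measurableType dT} {R : realType}.
Variable P : probability Omega R.

Definition norm2 (d : nat) (v : 'cV[R]_d) : R := Num.sqrt (\sum_j (v j 0) ^+ 2).

Definition G_meas (G : set (set Omega)) (f : Omega -> R) : Prop :=
  forall B : set R, measurable B -> G (f @^-1` B).

Definition cond_exp_version (G : set (set Omega)) (f g : Omega -> R) : Prop :=
  [/\ P.-integrable setT (EFin \o f), G_meas G g, P.-integrable setT (EFin \o g)
    & forall A, G A -> (\int[P]_(x in A) (g x)%:E = \int[P]_(x in A) (f x)%:E)%E].

Definition cond_exp_le (G : set (set Omega)) (f : Omega -> R) (c : R) : Prop :=
  exists g, cond_exp_version G f g /\ (\forall x \ae P, g x <= c).


Definition indep_sigmas (F : nat -> set (set Omega)) (I : set nat) : Prop :=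
  forall (s : seq nat) (A : nat -> set Omega), uniq s ->
    (forall t, t \in s -> I t /\ F t (A t)) ->
    P (\big[setI/setT]_(t <- s) A t) = (\prod_(t <- s) P (A t))%E.

End Defs.

Section Bandit.
Context {dT : measure_display} {Omega : measurableType dT} {R : realType}.
Context {N d : nat}.
(* contexts, actions, rewards *)
Variables (X : 'I_N -> nat -> Omega -> 'cV[R]_d) (a : nat -> Omega -> 'I_N)
          (Y : 'I_N -> nat -> Omega -> R).

Definition coord_preimages (Z : Omega -> 'cV[R]_d) : set (set Omega) :=
  [set A | exists j B, measurable B /\ A = (fun w => Z w j 0) @^-1` B].

Definition sigma_ctx (t : nat) : set (set Omega) :=
  <<s [set A | exists i, coord_preimages (X i t) A] >>.

Definition hist (t : nat) : set (set Omega) :=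
  <<s [set A |
        (exists tau i, (1 <= tau < t)%N /\ coord_preimages (X i tau) A)
     \/ (exists tau k, (1 <= tau < t)%N /\ A = a tau @^-1` [set k])
     \/ (exists tau B, (1 <= tau < t)%N /\ measurable B /\
           A = (fun w => Y (a tau w) tau w) @^-1` B)
     \/ (exists i, coord_preimages (X i t) A)] >>.

Definition xTb (x b : 'cV[R]_d) : R := (x^T *m b) 0 0.

Definition eta_noise (beta : 'cV[R]_d) (i : 'I_N) (t : nat) (w : Omega) : R :=
  Y i t w - xTb (X i t w) beta.

Definition YDR (pi : nat -> 'I_N -> Omega -> R) (cbeta : nat -> Omega -> 'cV[R]_d)
  (i : 'I_N) (t : nat) (w : Omega) : R :=
  let r := (if a t w == i then 1 else 0) / pi t i w in
  (1 - r) * xTb (X i t w) (cbeta t w) + r * Y (a t w) t w.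

Definition beta_hat (pi : nat -> 'I_N -> Omega -> R) (cbeta : nat -> Omega -> 'cV[R]_d)
  (lam : nat -> R) (t : nat) (w : Omega) : 'cV[R]_d :=
  invmx (\sum_(1 <= tau < t.+1) \sum_(i < N) (X i tau w *m (X i tau w)^T) + (lam t)%:M)
  *m (\sum_(1 <= tau < t.+1) \sum_(i < N) (YDR pi cbeta i tau w) *: X i tau w).

End Bandit.

Definition mean_gram {dT : measure_display} {Omega : measurableType dT} {R : realType}
  {N d : nat} (P : probability Omega R) (X : 'I_N -> nat -> Omega -> 'cV[R]_d) (t : nat)
  : 'M[R]_d :=
  \matrix_(j, k) fine ('E_P[(fun w => N%:R^-1 * \sum_(i < N) X i t w j 0 * X i t w k 0)%R])%E.

(* Main.v *)
(* Write [beta_hat - beta = M^-1 (S - lam beta)] where [M] is the regularised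
   Gram matrix and [S] sums the vectors
   [u_t = sum_i X_i(t) (Y^DR_i(t) - X_i(t)^T beta)].  Since [a_t] and the
   noise are conditionally independent given the history, [u_t] is a martingale
   difference, and its norm is at most [N (3 b + 2 |eta_{a_t}(t)|)].  On the
   other hand [M] differs from [t N] times a matrix that is at least [phi^2] by
   [lam I] plus a sum of independent centred matrices of Frobenius norm at most
   [2 N]; as soon as that sum has norm at most [lam], [M >= t N phi^2].

   Both sums are controlled by one dimension-free tail bound, obtained from the
   supermartingale-like quantity [exp (s sqrt (s^-2 + |S_n|^2))]: concavity of
   the square root linearises its increments, and the linear part has zero
   conditional mean.  Conditional moments of functions of [eta_{a_t}(t)] are
   computed arm by arm, using conditional probabilities of the events
   [eta_i(t) \in B] given the history.  A union bound over [t] concludes. *)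
Require Import Defs.
From HB Require Import structures.
From mathcomp Require Import all_boot all_order all_algebra.
From mathcomp Require Import all_classical all_reals all_analysis.
From mathcomp Require Import measurable_realfun.
From mathcomp Require Import sesquilinear spectral complex.
From mathcomp Require Import ring lra.
Import Order.TTheory GRing.Theory Num.Theory.
Import numFieldNormedType.Exports.
Import HBNNSimple.
Local Open Scope classical_set_scope.
Local Open Scope ring_scope.
Set Implicit Arguments.
Unset Strict Implicit.

(** * Exponential inequalities *)

(** The two sums need two filtrations. The noise [u_t] is centred given the full history, but (A3)
    relates only contexts of different rounds and says nothing about past actions or rewards, so the
    Gram deviations are run along the sigma-algebra of past contexts alone. The tail bound therefore
    accepts any suitable sequence of generators. The noise is unbounded, and [1 / pi_i(t)] is
    controlled only on the event that arm [i] is played. Hence the indicator of that event stays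
    next to the quotient in every conditional computation, and the partition of the space by the
    played arm recombines the pieces without a union over arms. The ridge term absorbs the whole
    Gram fluctuation and costs only the bias [lam |beta| <= lam]. With [L = log (12 t^2 / delta)]
    each of the two tails is [3 e^{-L} = delta / (4 t^2)], so a round fails with probability at most
    [delta / (2 t^2)], and these sum to at most [delta]. Both [lam] and the noise bound scale like
    [N sqrt (t L)], whose [N] cancels against [t N phi^2]. *)

Section real_inequalities.
Variable R : realType.
Implicit Types x y z c k : R.

Lemma expR_ge_quad x : 0 <= x -> 1 + x + x ^+ 2 / 2 <= expR x.
Proof.
move=> x0; rewrite /expR.
have -> : 1 + x + x ^+ 2 / 2 = series (exp_coeff x) 3.
  rewrite /series/= !big_nat_recr// big_nil /exp_coeff /= !factS fact0 expr0 expr1 !muln1.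
  by rewrite add0r !divr1.
apply: nondecreasing_cvgn_le; last exact: is_cvg_series_exp_coeff.
apply/nondecreasing_seqP => n; rewrite seriesSr lerDl.
exact: exp_coeff_ge0.
Qed.

(** This is [sinh x >= x]: the identity [(1 - x + x^2/2)(1 + x + x^2/2) = 1 + x^4/4] turns the
    quadratic lower bound on [expR x] into an upper bound on its inverse. *)
Lemma expR_subN_ge x : 0 <= x -> 2 * x <= expR x - expR (- x).
Proof.
move=> x0; have e1 := expR_ge_quad x0.
have e0 : 0 < expR x := expR_gt0 x.
rewrite expRN.
suff : (expR x)^-1 <= 1 - x + x ^+ 2 / 2 by lra.
rewrite -[leLHS]mul1r ler_pdivrMr//.
have q0 : 0 <= 1 - x + x ^+ 2 / 2 by have := sqr_ge0 (1 - x); nra.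
apply: (@le_trans _ _ ((1 - x + x ^+ 2 / 2) * (1 + x + x ^+ 2 / 2))); last exact: ler_wpM2l.
have := sqr_ge0 (x ^+ 2); nra.
Qed.

Lemma expR_sub_mono y z : 0 <= z -> z <= y -> expR z - z <= expR y - y.
Proof.
move=> z0 zy; have -> : expR y = expR z * expR (y - z) by rewrite -expRD addrC subrK.
have := expR_ge1Dx (y - z); have : 1 <= expR z by rewrite -expR0 ler_expR.
nra.
Qed.

(** For negative [z], [expR_subN_ge] shows that reflecting to [- z] can only increase [expR z - z];
    monotonicity on the half-line does the rest. The size of an increment may thus replace its
    signed value. *)
Lemma expR_sub_le y z : `|z| <= y -> expR z - z <= expR y - y.
Proof.
move=> zy; case: (leP 0 z) => z0; first by apply: expR_sub_mono => //; rewrite -(ger0_norm z0).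
apply: (@le_trans _ _ (expR (- z) - (- z))).
  have /expR_subN_ge : 0 <= - z by rewrite oppr_ge0 ltW.
  by rewrite opprK; lra.
by apply: expR_sub_mono; [rewrite oppr_ge0 ltW|rewrite -(ltr0_norm z0)].
Qed.

Lemma expR_ge_twice y : 2 * y <= expR y.
Proof.
case: (leP 0 y) => y0; last by have := expR_gt0 y; lra.
have := expR_ge_quad y0; have := sqr_ge0 (y - 1); nra.
Qed.

(* Dominates [expR z - z + y ^+ 2 / 2] for all [`|z| <= y]; the quadratic term
   pays for the smoothing of the norm in [rad]. *)
Definition pot y := expR y - y + y ^+ 2 / 2.

Lemma pot_ge0 y : 0 <= pot y.
Proof. by have := expR_ge_twice y; have := expR_gt0 y; have := sqr_ge0 y; rewrite /pot; lra. Qed.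

Lemma pot_ge y : y <= pot y.
Proof. by have := expR_ge_twice y; have := expR_gt0 y; have := sqr_ge0 y; rewrite /pot; lra. Qed.

Lemma pot_mono y z : 0 <= z -> z <= y -> pot z <= pot y.
Proof.
move=> z0 zy; have := expR_sub_mono z0 zy.
move=> h; rewrite /pot; have : z ^+ 2 <= y ^+ 2 by nra.
by move: h; lra.
Qed.

(** Sub-Gaussian form for bounded increments. Beyond [1/2] the factor [expR (2 y^2 - y)] is expanded
    to first order; below, [expR y <= (1 - y/2)^-2] reduces the claim to polynomials. *)
Lemma pot_le_expR_sqr y : 0 <= y -> pot y <= expR (2 * y ^+ 2).
Proof.
move=> y0; rewrite /pot; case: (leP y 2^-1) => y1; last first.
  have -> : expR (2 * y ^+ 2) = expR y * expR (2 * y ^+ 2 - y).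
    by rewrite -expRD addrC subrK.
  have e1 := expR_ge1Dx (2 * y ^+ 2 - y).
  have e2 : 1 <= expR y by rewrite -expR0 ler_expR.
  have w0 : 0 <= 2 * y ^+ 2 - y by nra.
  have e3 : expR y * (1 + (2 * y ^+ 2 - y)) <= expR y * expR (2 * y ^+ 2 - y).
    by rewrite ler_wpM2l ?expR_ge0.
  have e4 : 2 * y ^+ 2 - y <= expR y * (2 * y ^+ 2 - y) by rewrite ler_peMl.
  have := sqr_ge0 y; lra.
apply: le_trans (expR_ge1Dx _).
suff : expR y <= 1 + y + 3 / 2 * y ^+ 2 by lra.
have -> : expR y = (expR (- (y / 2)) ^+ 2)^-1.
  by rewrite -expRM_natl -expRN mulrN opprK mulrC divfK.
have e1 : 1 - y / 2 <= expR (- (y / 2)) := expR_ge1Dx _.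
have e2 : 0 < (1 - y / 2) ^+ 2 by rewrite exprn_gt0//; lra.
have e3 : (1 - y / 2) ^+ 2 <= expR (- (y / 2)) ^+ 2.
  by rewrite ler_pXn2r// ?nnegrE ?expR_ge0//; lra.
apply: (@le_trans _ _ (((1 - y / 2) ^+ 2)^-1)).
  by rewrite lef_pV2// posrE// (lt_le_trans e2).
rewrite -[leLHS]mul1r ler_pdivrMr// mulrC.
have : 0 <= y ^+ 2 * (3 / 4 - 5 / 4 * y) by rewrite mulr_ge0 ?sqr_ge0//; lra.
have : 0 <= (y ^+ 2) ^+ 2 by exact: sqr_ge0.
by rewrite !expr2; nra.
Qed.

(** Bounds the starting value of the potential, where [s * rad = 1], and is the source of the factor
    3 in the tail bounds. The proof is [e <= (6/5)^6 < 3]. *)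
Lemma expR1_le3 : expR 1 <= 3 :> R.
Proof.
have -> : expR 1 = ((expR (- (6 %:R)^-1)) ^+ 6)^-1 :> R.
  by rewrite -expRM_natl -expRN mulrN opprK mulfV.
have e1 : 5 / 6 <= expR (- (6 %:R)^-1) :> R by have := expR_ge1Dx (- (6 %:R)^-1 : R); lra.
have e3 : (5 / 6) ^+ 6 <= expR (- (6 %:R)^-1) ^+ 6 :> R.
  by rewrite ler_pXn2r// ?nnegrE ?expR_ge0//; lra.
have e2 : 0 < (5 / 6) ^+ 6 :> R by rewrite exprn_gt0//; lra.
apply: (@le_trans _ _ (((5 / 6) ^+ 6)^-1)).
  by rewrite lef_pV2// posrE// (lt_le_trans e2).
rewrite -[leLHS]mul1r ler_pdivrMr// !exprS expr0; lra.
Qed.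

(** The excess over 1 must stay of order [k^2] for the product over the rounds to remain Gaussian in
    [k]. It comes from [e^y - 1 - y <= y^2 e^y] at [y = k z], with [z^2] absorbed by two further
    factors [e^z]. *)
Lemma pot_le_small k z : 0 <= k <= 1 -> 0 <= z -> pot (k * z) <= 1 + 3 / 2 * k ^+ 2 * expR (3 * z).
Proof.
move=> /andP[k0 k1] z0.
have y0 : 0 <= k * z by rewrite mulr_ge0.
have h : expR (k * z) - 1 - k * z <= (k * z) ^+ 2 * expR (k * z).
  have := expR_ge1Dx (- (k * z)); have := expR_gt0 (k * z).
  have : expR (k * z) * expR (- (k * z)) = 1 by rewrite -expRD addrN expR0.
  move: (k * z) y0 => y y0; move: (expR y) (expR (- y)) => E F EF E0 F1.
  have : E * (1 - y) <= E * F by rewrite ler_pM2l//; lra.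
  rewrite EF => e1; have : y * (E * (1 - y)) <= y * 1 by rewrite ler_wpM2l.
  rewrite expr2; lra.
have zE : (k * z) ^+ 2 * expR (k * z) <= k ^+ 2 * expR (3 * z).
  rewrite exprMn -mulrA ler_wpM2l ?sqr_ge0//.
  have -> : 3 * z = z + z + z by lra.
  rewrite !expRD expr2; apply: ler_pM; rewrite ?mulr_ge0 ?expR_ge0//; last first.
    by rewrite ler_expR; nra.
  by apply: ler_pM => //; have := expR_ge_twice z; lra.
have : (k * z) ^+ 2 <= (k * z) ^+ 2 * expR (k * z).
  by rewrite ler_peMr ?sqr_ge0// -expR0 ler_expR.
by rewrite /pot; lra.
Qed.

Lemma pot_le_expR y : 0 <= y -> pot y <= 2 * expR y.
Proof. by move=> y0; have := expR_ge_quad y0; have := expR_gt0 y; rewrite /pot; lra. Qed.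

End real_inequalities.

(** * A potential for vector martingales *)

Section euclidean.
Variables (R : realType) (I : finType).
Implicit Types x y : I -> R.

Definition ip x y : R := \sum_k x k * y k.
Definition nrm x : R := Num.sqrt (\sum_k x k ^+ 2).

Lemma nrm_ge0 x : 0 <= nrm x. Proof. exact: sqrtr_ge0. Qed.

Lemma sum_sqr_ge0 x : 0 <= \sum_k x k ^+ 2.
Proof. by apply: sumr_ge0 => k _; exact: sqr_ge0. Qed.

Lemma sqr_nrm x : nrm x ^+ 2 = \sum_k x k ^+ 2.
Proof. by rewrite sqr_sqrtr// sum_sqr_ge0. Qed.

Lemma normr_coord_le x k : `|x k| <= nrm x.
Proof.
rewrite -(ger0_norm (nrm_ge0 x)) -ler_sqr ?nnegrE// !real_normK ?num_real// sqr_nrm.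
by rewrite (bigD1 k)//= lerDl sumr_ge0// => i _; exact: sqr_ge0.
Qed.

Lemma nrm_eq0 x : nrm x = 0 -> forall k, x k = 0.
Proof. by move=> x0 k; have := normr_coord_le x k; rewrite x0 normr_le0 => /eqP. Qed.

Lemma sqr_nrmD x y : nrm (fun k => x k + y k) ^+ 2 = nrm x ^+ 2 + 2 * ip x y + nrm y ^+ 2.
Proof.
rewrite !sqr_nrm /ip mulr_sumr -!big_split/=; apply: eq_bigr => k _; ring.
Qed.

Lemma nrmZ c x : nrm (fun k => c * x k) = `|c| * nrm x.
Proof.
rewrite /nrm -sqrtr_sqr -sqrtrM ?sqr_ge0//; congr (Num.sqrt _).
by rewrite mulr_sumr; apply: eq_bigr => k _; rewrite exprMn.
Qed.

Lemma ip_le x y : ip x y <= nrm x * nrm y.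
Proof.
have [|] := leP (nrm x * nrm y) 0.
  have n0 : 0 <= nrm x * nrm y by rewrite mulr_ge0 ?nrm_ge0.
  rewrite le_eqVlt ltNge n0 orbF => /eqP xy0; rewrite xy0 /ip big1// => k _.
  by move/eqP: xy0; rewrite mulf_eq0 => /orP[] /eqP /nrm_eq0 ->; rewrite ?mulr0 ?mul0r.
move=> n0; have := sqr_ge0 (nrm (fun k => nrm y * x k + - nrm x * y k)).
rewrite sqr_nrmD !nrmZ normrN !ger0_norm ?nrm_ge0//.
have -> : ip (fun k => nrm y * x k) (fun k => - nrm x * y k) = - (nrm x * nrm y) * ip x y.
  by rewrite /ip mulr_sumr; apply: eq_bigr => k _; ring.
rewrite (_ : _ + _ = 2 * (nrm x * nrm y) * (nrm x * nrm y - ip x y)); last by ring.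
by rewrite pmulr_rge0 ?subr_ge0//; lra.
Qed.

Lemma normr_ip_le x y : `|ip x y| <= nrm x * nrm y.
Proof.
rewrite ler_norml ip_le andbT lerNl -[nrm x]mul1r -(normrN1 R) -nrmZ.
apply: le_trans (ip_le _ _); rewrite /ip -sumrN; apply: ler_sum => k _; lra.
Qed.

Lemma nrmD_le x y : nrm (fun k => x k + y k) <= nrm x + nrm y.
Proof.
rewrite -ler_sqr ?nnegrE ?addr_ge0 ?nrm_ge0// sqr_nrmD.
have := ip_le x y; lra.
Qed.

Lemma nrm_sum_le (J : Type) (r : seq J) (F : J -> I -> R) :
  nrm (fun k => \sum_(i <- r) F i k) <= \sum_(i <- r) nrm (F i).
Proof.
elim: r => [|i r IH].
  rewrite big_nil /nrm big1 ?sqrtr0// => k _; by rewrite big_nil expr0n.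
rewrite big_cons (_ : (fun k => _) = fun k => F i k + \sum_(j <- r) F j k).
  exact: le_trans (nrmD_le _ _) (lerD (lexx _) IH).
by apply/funext => k; rewrite big_cons.
Qed.

Section step.
Variables (s : R) (s0 : 0 < s).

(* The norm smoothed at scale [s^-1]: [rad x >= s^-1] keeps the linearisation
   of its increments, which divides by [rad x], from blowing up near [0]. *)
Definition rad x : R := Num.sqrt ((s^-1) ^+ 2 + nrm x ^+ 2).

Lemma rad_arg_ge0 x : 0 <= (s^-1) ^+ 2 + nrm x ^+ 2.
Proof. by rewrite addr_ge0 ?sqr_ge0. Qed.

Lemma sqr_rad x : rad x ^+ 2 = (s^-1) ^+ 2 + nrm x ^+ 2.
Proof. by rewrite sqr_sqrtr// rad_arg_ge0. Qed.

Lemma rad_ge x : s^-1 <= rad x.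
Proof.
by rewrite -ler_sqr ?nnegrE ?sqrtr_ge0 ?invr_ge0 ?(ltW s0)// sqr_rad lerDl sqr_ge0.
Qed.

Lemma rad_gt0 x : 0 < rad x.
Proof. by apply: lt_le_trans (rad_ge x); rewrite invr_gt0. Qed.

Lemma nrm_le_rad x : nrm x <= rad x.
Proof.
by rewrite -ler_sqr ?nnegrE ?sqrtr_ge0 ?nrm_ge0// sqr_rad lerDr sqr_ge0.
Qed.

Lemma radD_le x y : rad (fun k => x k + y k) <= rad x + nrm y.
Proof.
rewrite -ler_sqr ?nnegrE ?addr_ge0 ?nrm_ge0 ?(ltW (rad_gt0 _))// sqr_rad.
have := nrmD_le x y; have := nrm_le_rad x; have := sqr_rad x.
have := nrm_ge0 x; have := nrm_ge0 y; have := nrm_ge0 (fun k => x k + y k).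
have := rad_gt0 x; rewrite sqr_nrmD; have := ip_le x y; nra.
Qed.

Lemma rad_lip x y : `|rad (fun k => x k + y k) - rad x| <= nrm y.
Proof.
rewrite ler_norml lerBlDr [nrm y + _]addrC radD_le andbT lerNl opprB lerBlDr.
rewrite addrC -[nrm y]mul1r -(normrN1 R) -nrmZ.
apply: le_trans (radD_le _ _); rewrite le_eqVlt; apply/orP; left; apply/eqP.
by congr rad; apply/funext => k; ring.
Qed.

(** Tangent-line bound for the square root at [rad x ^+ 2], obtained from
    [(rad (x + y) - rad x)^2 >= 0]. The floor [rad x >= s^-1] then replaces [1 / rad x] by [s], in
    the quadratic remainder only. *)
Lemma rad_concave x y :
  rad (fun k => x k + y k) - rad x <= ip x y / rad x + s * nrm y ^+ 2 / 2.
Proof.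
have r0 := rad_gt0 x.
have e1 : rad (fun k => x k + y k) - rad x <= (ip x y + nrm y ^+ 2 / 2) / rad x.
  rewrite ler_pdivlMr//.
  have := sqr_rad x; have := sqr_rad (fun k => x k + y k); rewrite sqr_nrmD.
  have := sqr_ge0 (rad (fun k => x k + y k) - rad x); rewrite !expr2; lra.
apply: le_trans e1 _; rewrite mulrDl lerD2l ler_pdivrMr//.
have : 1 <= s * rad x by rewrite -(mulfV (lt0r_neq0 s0)) ler_pM2l ?rad_ge.
have := sqr_ge0 (nrm y); nra.
Qed.

(** With [z] the increment of [rad], [expR (s z) <= expR (s |y|) - s |y| + s z], and [rad_concave]
    bounds the isolated linear term; [pot] collects everything else. The last summand is linear in
    [y], so it integrates to zero against a centred increment. *)
Lemma expR_rad_step x y :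
  expR (s * rad (fun k => x k + y k)) <=
  expR (s * rad x) * pot (s * nrm y) + expR (s * rad x) * (s / rad x) * ip x y.
Proof.
rewrite (_ : _ + _ = expR (s * rad x) * (pot (s * nrm y) + s * (ip x y / rad x))); last by ring.
rewrite -[in leLHS](subrK (rad x) (rad (fun k => _))) mulrDr expRD mulrC.
rewrite ler_wpM2l ?expR_ge0//.
set z := rad _ - rad x.
have zy : `|s * z| <= s * nrm y.
  by rewrite normrM (gtr0_norm s0) ler_pM2l// rad_lip.
have := expR_sub_le zy; have : s * z <= s * (ip x y / rad x + s * nrm y ^+ 2 / 2).
  by rewrite ler_pM2l// rad_concave.
rewrite /pot exprMn (expr2 s); lra.
Qed.

End step.
End euclidean.

Lemma nrm_outer (R : realType) (I J : finType) (x : I -> R) (y : J -> R) :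
  nrm (fun p : I * J => x p.1 * y p.2) = nrm x * nrm y.
Proof.
rewrite /nrm -sqrtrM ?sum_sqr_ge0//; congr Num.sqrt.
rewrite mulr_suml (eq_bigr (fun i => \sum_j (x i * y j) ^+ 2)).
  by rewrite pair_big.
by move=> i _; rewrite mulr_sumr; apply: eq_bigr => j _; rewrite exprMn.
Qed.

(** * Conditioning on a sub-sigma-algebra *)

Section conditioning.
Local Open Scope ereal_scope.
Context d (T : measurableType d) (R : realType) (mu : {measure set T -> \bar R}).
Implicit Types (f g : T -> \bar R) (W : T -> R).

Lemma integral_nnsfun_comp_mul f W (h : {nnsfun R >-> R}) :
  measurable_fun setT f -> (forall x, 0 <= f x) -> measurable_fun setT W ->
  \int[mu]_x ((h (W x))%:E * f x) =
  \sum_(r \in range h) (r%:E * \int[mu]_(x in W @^-1` (h @^-1` [set r])) f x).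
Proof.
move=> mf f0 mW.
have mA r : measurable (W @^-1` (h @^-1` [set r])).
  by rewrite -[_ @^-1` _]setTI; apply: mW => //; exact: measurable_sfunP.
transitivity (\int[mu]_x (\sum_(r \in range h)
    (r * \1_(h @^-1` [set r]) (W x))%:E * f x)).
  apply: eq_integral => x _; rewrite -ge0_mule_fsuml => [|r]; last exact: nnfun_muleindic_ge0.
  by rewrite fsumEFin // -(fimfunE _ (W x)).
have mi r : measurable_fun setT (fun x => (r * \1_(h @^-1` [set r]) (W x))%:E).
  by apply/measurable_EFinP; apply: measurable_funM => //; exact: measurableT_comp.
rewrite ge0_integral_fsum//; last 2 first.
  - by move=> r; exact: emeasurable_funM.
  - by move=> r x _; rewrite mule_ge0 ?f0// nnfun_muleindic_ge0.
apply: eq_fsbigr => r rh.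
have r0 : (0 <= r)%R by move: rh; rewrite inE => -[t _ <-].
under eq_integral do rewrite EFinM -muleA.
rewrite ge0_integralZl//; last 2 first.
- apply: emeasurable_funM => //; apply/measurable_EFinP; exact: measurableT_comp.
- by move=> x _; rewrite mule_ge0 ?lee_fin.
congr (_ * _); rewrite [RHS]integral_mkcond; apply: eq_integral => x _.
by rewrite epatch_indic muleC.
Qed.

(** The weight is approximated by simple functions of its value, [h n (W x)], rather than of [x].
    Their level sets are preimages under [W], the only sets on which [f] and [g] are compared. *)
Lemma le_integral_weight f g W :
  measurable_fun setT f -> measurable_fun setT g ->
  (forall x, 0 <= f x) -> (forall x, 0 <= g x) ->
  measurable_fun setT W -> (forall x, (0 <= W x)%R) ->
  (forall B, measurable B ->
     \int[mu]_(x in W @^-1` B) f x <= \int[mu]_(x in W @^-1` B) g x) ->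
  \int[mu]_x ((W x)%:E * f x) <= \int[mu]_x ((W x)%:E * g x).
Proof.
move=> mf mg f0 g0 mW W0 fg.
pose p (y : R) : \bar R := (Num.max y 0)%:E.
have mp : measurable_fun setT p.
  by apply/measurable_EFinP; apply: measurable_maxr.
pose h := nnsfun_approx measurableT mp.
have hW x : (fun n => (h n (W x))%:E) @ \oo --> (W x)%:E.
  rewrite (_ : (W x)%:E = p (W x)); last by rewrite /p; congr _%:E; apply/esym/max_idPl.
  by apply: cvg_nnsfun_approx => // t _; rewrite /p lee_fin le_max lexx orbT.
have intE f' : measurable_fun setT f' -> (forall x, 0 <= f' x) ->
    (fun n => \int[mu]_x ((h n (W x))%:E * f' x)) @ \oo --> \int[mu]_x ((W x)%:E * f' x).
  move=> mf' f'0.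
  have -> : \int[mu]_x ((W x)%:E * f' x) =
      \int[mu]_x (limn (fun n => (h n (W x))%:E * f' x)).
    apply: eq_integral => x _; apply/esym/cvg_lim => //.
    have := f'0 x; case: (f' x) => [r r0|_|//].
    - by apply: cvgeZr.
    (* Infinite values: where [W x = 0] the products converge only because the approximants vanish
       there as well; elsewhere these are eventually positive and the products are [+oo]. *)
    - have [W0'|W0'] := eqVneq (W x) 0%R.
        rewrite W0' mul0e; apply: cvg_near_cst; near=> n.
        suff -> : h n 0%R = 0%R by rewrite mul0e.
        apply/eqP; rewrite eq_le; apply/andP; split; last by [].
        rewrite -lee_fin; have : (h n 0%R)%:E <= p 0%R.
          by rewrite nnsfun_approxE; apply: le_approx => // t _; rewrite /p lee_fin le_max lexx orbT.
        by rewrite /p maxxx.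
      have Wp : (0 < W x)%R by rewrite lt0r W0' W0.
      rewrite gt0_muley//; apply: cvg_near_cst.
      have := hW x; move/fine_cvgP => [_] /=; move/cvgr_gt => /(_ _ Wp).
      by apply: filterS => n /= hn; rewrite gt0_muley.
  apply: cvg_monotone_convergence => //.
  - by move=> n; apply: emeasurable_funM => //; apply/measurable_EFinP; exact: measurableT_comp.
  - by move=> n x _; rewrite mule_ge0// lee_fin.
  - by move=> x _ a b ab; rewrite lee_wpmul2r// lee_fin; exact/lefP/nd_nnsfun_approx.
have cf := intE _ mf f0; have cg := intE _ mg g0.
rewrite -(cvg_lim _ cf)// -(cvg_lim _ cg)//.
apply: lee_lim; [by apply/cvg_ex; exists (\int[mu]_x ((W x)%:E * f x))|by apply/cvg_ex; exists (\int[mu]_x ((W x)%:E * g x))|].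
near=> n; rewrite !integral_nnsfun_comp_mul// !fsbig_finite//=.
rewrite big_seq [leRHS]big_seq; apply: lee_sum => r.
rewrite in_fset_set// inE => -[t _ <-].
by rewrite lee_wpmul2l ?lee_fin//; apply: fg; exact: measurable_sfunP.
Unshelve. all: by end_near. Qed.

Lemma eq_integral_weight f g W :
  measurable_fun setT f -> measurable_fun setT g ->
  (forall x, 0 <= f x) -> (forall x, 0 <= g x) ->
  measurable_fun setT W -> (forall x, (0 <= W x)%R) ->
  (forall B, measurable B ->
     \int[mu]_(x in W @^-1` B) f x = \int[mu]_(x in W @^-1` B) g x) ->
  \int[mu]_x ((W x)%:E * f x) = \int[mu]_x ((W x)%:E * g x).
Proof.
move=> mf mg f0 g0 mW W0 fg; apply/eqP; rewrite eq_le.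
by apply/andP; split; apply: le_integral_weight => // B mB; rewrite fg.
Qed.

End conditioning.

Section measurability.
Context d (T : measurableType d) (R : realType).

Lemma measurable_nrm (I : finType) (S : I -> T -> R) :
  (forall k, measurable_fun setT (S k)) ->
  measurable_fun setT (fun x => nrm (fun k => S k x)).
Proof.
move=> mS; rewrite /nrm; apply: measurableT_comp.
  by apply: continuous_measurable_fun; exact: sqrt_continuous.
apply: measurable_sum => k; exact: measurable_funX.
Qed.

Lemma measurable_rad (I : finType) (s : R) (S : I -> T -> R) :
  (forall k, measurable_fun setT (S k)) ->
  measurable_fun setT (fun x => rad s (fun k => S k x)).
Proof.
move=> mS; rewrite /rad; apply: measurableT_comp.
  by apply: continuous_measurable_fun; exact: sqrt_continuous.
by apply: measurable_funD => //; apply: measurable_funX; exact: measurable_nrm.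
Qed.

Lemma measurable_pot (f : T -> R) : measurable_fun setT f ->
  measurable_fun setT (fun x => pot (f x)).
Proof.
move=> mf; rewrite /pot; apply: measurable_funD; last first.
  by apply: measurable_funM => //; exact: measurable_funX.
by apply: measurable_funB => //; exact: measurableT_comp.
Qed.

Lemma measurable_sum_range (m n : nat) (F : nat -> T -> R) :
  (forall u, (m <= u < n)%N -> measurable_fun setT (F u)) ->
  measurable_fun setT (fun x => \sum_(m <= u < n) F u x).
Proof.
elim: n => [|n IH] mF.
  rewrite (_ : (fun x => _) = cst 0); first exact: measurable_cst.
  by apply/funext => x; rewrite big_geq.
have [mn|nm] := leqP m n; last first.
  rewrite (_ : (fun x => _) = cst 0); first exact: measurable_cst.
  by apply/funext => x; rewrite big_geq.
rewrite (_ : (fun x => _) = fun x => \sum_(m <= u < n) F u x + F n x).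
  apply: measurable_funD; last by apply: mF; rewrite mn /=.
  by apply: IH => u /andP[mu un]; apply: mF; rewrite mu ltnW.
by apply/funext => x; rewrite big_nat_recr.
Qed.

Lemma measurable_inv_pos (f : T -> R) : (forall x, 0 < f x) ->
  measurable_fun setT f -> measurable_fun setT (fun x => (f x)^-1).
Proof.
move=> f0 mf; rewrite (_ : (fun x => _) = (fun x => f x `^ (-1))).
  exact: measurableT_comp (@measurable_powR R (-1)) mf.
by apply/funext => x; rewrite powR_inv1// ltW.
Qed.

End measurability.

(** * Weights measurable for a sub-sigma-algebra *)

Section sub_sigma_algebra.
Context d (T : measurableType d) (R : realType) (P : probability T R).
Variable C : set (set T).
Hypothesis mC : C `<=` measurable.
Implicit Types (f g h W : T -> R).

Notation G := <<s C >>.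

Lemma G_measP f : G_meas G f <-> measurable_fun setT (f : g_sigma_algebraType C -> R).
Proof.
split=> [Gf _ B mB|mf B mB]; first by rewrite setTI; exact: Gf.
by rewrite -[_ @^-1` _]setTI; exact: mf.
Qed.

Lemma sub_measurable A : G A -> measurable A.
Proof. by apply: smallest_sub => //; exact: sigma_algebra_measurable. Qed.

Lemma G_meas_measurable f : G_meas G f -> measurable_fun setT f.
Proof. by move=> Gf _ B mB; rewrite setTI; apply: sub_measurable; exact: Gf. Qed.

Lemma sub_setI A B : G A -> G B -> G (A `&` B).
Proof. exact: (@measurableI _ (g_sigma_algebraType C)). Qed.

Local Open Scope ereal_scope.

Lemma integral_weight_le (f g : T -> R) W :
  measurable_fun setT f -> measurable_fun setT g ->
  (forall x, 0 <= f x)%R -> (forall x, 0 <= g x)%R ->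
  G_meas G W -> (forall x, 0 <= W x)%R ->
  (forall A, G A -> \int[P]_(x in A) (f x)%:E <= \int[P]_(x in A) (g x)%:E) ->
  forall A, G A -> \int[P]_(x in A) (W x * f x)%:E <= \int[P]_(x in A) (W x * g x)%:E.
Proof.
move=> mf mg f0 g0 GW W0 fg A GA.
have mA := sub_measurable GA; have mW := G_meas_measurable GW.
have e (f' : T -> R) : \int[P]_(x in A) (W x * f' x)%:E =
    \int[P]_x ((W x)%:E * (f' x * \1_A x)%:E).
  rewrite integral_mkcond; apply: eq_integral => x _.
  by rewrite epatch_indic -!EFinM mulrA.
have mr (f' : T -> R) : measurable_fun setT f' ->
    measurable_fun setT (fun x => (f' x * \1_A x)%:E).
  by move=> mf'; apply/measurable_EFinP; apply: measurable_funM => //; exact: measurable_indic.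
rewrite !e; apply: le_integral_weight => //; try exact: mr.
- by move=> x; rewrite lee_fin mulr_ge0.
- by move=> x; rewrite lee_fin mulr_ge0.
- move=> B mB; have e2 (f' : T -> R) : \int[P]_(x in W @^-1` B) (f' x * \1_A x)%:E =
     \int[P]_(x in (W @^-1` B) `&` A) (f' x)%:E.
    by rewrite integral_mkcondr; apply: eq_integral => x _; rewrite epatch_indic EFinM.
  by rewrite !e2; apply: fg; apply: sub_setI => //; exact: GW.
Qed.

(** Taking out a [G]-measurable factor, for signed and possibly unbounded weights. The positive and
    negative parts of [h] have equal integrals on each event of [G], hence equal integrals against
    each nonnegative part of [W]. *)
Lemma integral_weight_eq0 h W :
  P.-integrable setT (EFin \o h) -> G_meas G W ->
  P.-integrable setT (EFin \o (fun x => W x * h x)%R) ->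
  (forall A, G A -> \int[P]_(x in A) (h x)%:E = 0) ->
  forall A, G A -> \int[P]_(x in A) (W x * h x)%:E = 0.
Proof.
move=> ih GW iWh h0 A GA.
have mA := sub_measurable GA; have mW := G_meas_measurable GW.
have mh : measurable_fun setT h by apply/measurable_EFinP; exact: measurable_int ih.
pose p (f : T -> R) x := Num.max (f x) 0%R; pose n (f : T -> R) x := Num.max (- f x)%R 0%R.
have p0 f x : (0 <= p f x)%R by rewrite le_max lexx orbT.
have n0 f x : (0 <= n f x)%R by rewrite le_max lexx orbT.
have pnB f x : f x = (p f x - n f x)%R.
  rewrite /p /n; have [f0|f0] := leP 0%R (f x).
    by rewrite max_r; lra.
  by rewrite max_l; lra.
have pnD f x : `|f x|%R = (p f x + n f x)%R.
  rewrite /p /n; have [f0|f0] := leP 0%R (f x).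
    by rewrite ger0_norm// max_r; lra.
  by rewrite ltr0_norm// max_l; lra.
have mp f : measurable_fun setT f -> measurable_fun setT (p f).
  by move=> mf; exact: measurable_maxr.
have mn f : measurable_fun setT f -> measurable_fun setT (n f).
  by move=> mf; apply: measurable_maxr => //; exact: measurable_funN.
have dom (u f : T -> R) : measurable_fun setT u -> P.-integrable setT (EFin \o f) ->
    (forall x, 0 <= u x <= `|f x|)%R -> P.-integrable A (EFin \o u).
  move=> mu fi uf; apply: (@integrableS _ _ _ _ setT) => //.
  apply: le_integrable fi => //; first exact/measurable_EFinP.
  by move=> x _; rewrite /= lee_fin; have /andP[u0 ?] := uf x; rewrite ger0_norm.
have eqh A' : G A' -> \int[P]_(x in A') (p h x)%:E = \int[P]_(x in A') (n h x)%:E.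
  move=> GA'; have mA' := sub_measurable GA'.
  have ip : P.-integrable A' (EFin \o p h).
    apply: (@integrableS _ _ _ _ setT) => //; apply: le_integrable ih => //.
      by apply/measurable_EFinP; exact: mp.
    by move=> x _; rewrite /= lee_fin ger0_norm// pnD lerDl ?v0 ?n0.
  have iN : P.-integrable A' (EFin \o n h).
    apply: (@integrableS _ _ _ _ setT) => //; apply: le_integrable ih => //.
      by apply/measurable_EFinP; exact: mn.
    by move=> x _; rewrite /= lee_fin ger0_norm// pnD lerDr.
  have := h0 _ GA'.
  rewrite (eq_integral (fun x => (p h x)%:E - (n h x)%:E)); last first.
    by move=> x _; rewrite -EFinB -pnB.
  rewrite integralB_EFin// => /eqP; rewrite sube_eq ?add0e; first by move/eqP.
  - exact: integrable_fin_num.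
  - by rewrite fin_num_adde_defl//; exact: integrable_fin_num.
have eqW V : G_meas G V -> (forall x, 0 <= V x)%R ->
   \int[P]_(x in A) (V x * p h x)%:E = \int[P]_(x in A) (V x * n h x)%:E.
  move=> GV V0; apply/eqP; rewrite eq_le; apply/andP; split.
    by apply: integral_weight_le => //; [exact: mp|exact: mn|move=> A' GA'; rewrite eqh].
  by apply: integral_weight_le => //; [exact: mn|exact: mp|move=> A' GA'; rewrite eqh].
have Gp : G_meas G (p W) by apply/G_measP; apply: measurable_maxr => //; exact/G_measP.
have Gn : G_meas G (n W).
  by apply/G_measP; apply: measurable_maxr => //; apply: measurable_funN; exact/G_measP.
(* The grouping [W h = u - v] has [u + v = |W h|], so integrability of the product alone makes both
   pieces integrable. *)
pose u x := (p W x * p h x + n W x * n h x)%R.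
pose v x := (p W x * n h x + n W x * p h x)%R.
have u0 x : (0 <= u x)%R by rewrite addr_ge0 ?mulr_ge0.
have v0 x : (0 <= v x)%R by rewrite addr_ge0 ?mulr_ge0.
have uvB x : (W x * h x = u x - v x)%R.
  by rewrite (pnB W) (pnB h) /u /v; ring.
have uvD x : (`|W x * h x| = u x + v x)%R.
  by rewrite normrM (pnD W) (pnD h) /u /v; ring.
have mM (V k : T -> R) : G_meas G V -> measurable_fun setT k -> measurable_fun setT (fun x => V x * k x)%R.
  by move=> GV mk; apply: measurable_funM => //; exact: G_meas_measurable.
have mu : measurable_fun setT u by apply: measurable_funD; apply: mM => //; [exact: mp|exact: mn].
have mv : measurable_fun setT v by apply: measurable_funD; apply: mM => //; [exact: mn|exact: mp].
have iu : P.-integrable A (EFin \o u).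
  by apply: (dom _ _ mu iWh) => x; rewrite u0 /= uvD lerDl ?v0 ?n0.
have iv : P.-integrable A (EFin \o v).
  by apply: (dom _ _ mv iWh) => x; rewrite v0 /= uvD lerDr ?u0.
rewrite (eq_integral (fun x => (u x)%:E - (v x)%:E)); last first.
  by move=> x _; rewrite -EFinB -uvB.
rewrite integralB_EFin//.
suff -> : \int[P]_(x in A) (u x)%:E = \int[P]_(x in A) (v x)%:E.
  by rewrite subee//; exact: integrable_fin_num.
rewrite /u /v; under eq_integral do rewrite EFinD.
under [RHS]eq_integral do rewrite EFinD.
have mE (V k : T -> R) : G_meas G V -> measurable_fun setT k ->
    measurable_fun A (fun x => (V x * k x)%:E).
  by move=> GV mk; apply: measurable_funTS; apply/measurable_EFinP; exact: mM.
rewrite !ge0_integralD//; try (by move=> x _; rewrite lee_fin mulr_ge0);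
  try (by apply: mE => //; exact: mp); try (by apply: mE => //; exact: mn).
by rewrite !eqW.
Qed.

End sub_sigma_algebra.

(** * Dimension-free martingale tail bound *)

Section concentration.
Local Open Scope ereal_scope.
Context d (T : measurableType d) (R : realType) (P : probability T R).
Context (I : finType).
Implicit Types (S xi : I -> T -> R).

Section one_step.
Variable C : set (set T).
Hypothesis mC : C `<=` measurable.
Variables (S xi : I -> T -> R) (s M : R).
Hypotheses (s0 : (0 < s)%R) (M0 : (0 <= M)%R).
Hypothesis GS : forall k, G_meas <<s C>> (S k).
Hypothesis ixi : forall k, P.-integrable setT (EFin \o xi k).
Hypothesis xi0 : forall k A, <<s C>> A -> \int[P]_(x in A) (xi k x)%:E = 0.
Hypothesis xiM : forall A, <<s C>> A ->
  \int[P]_(x in A) (pot (s * nrm (xi^~ x)))%:E <= M%:E * P A.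
Hypothesis iS : P.-integrable setT (fun x => (expR (s * rad s (S^~ x)))%:E).

Let mS k := G_meas_measurable mC (GS k).
Let mxi k : measurable_fun setT (xi k).
Proof. by apply/measurable_EFinP; exact: measurable_int (ixi k). Qed.
Let W x := expR (s * rad s (S^~ x)).
Let W0 x : (0 <= W x)%R := expR_ge0 _.
Let GW : G_meas <<s C>> W.
Proof.
apply/G_measP; rewrite /W; apply: measurableT_comp => //.
by apply: measurable_funM => //; apply: measurable_rad => k; exact/G_measP.
Qed.
Let V k x : R := W x * (s / rad s (S^~ x)) * S k x.
Let GV k : G_meas <<s C>> (V k).
Proof.
apply/G_measP; rewrite /V; apply: measurable_funM; last exact/G_measP.
apply: measurable_funM; first exact/G_measP.
apply: measurable_funM => //; apply: measurable_inv_pos => [x|]; first exact: rad_gt0.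
by apply: measurable_rad => i; exact/G_measP.
Qed.
Let q x : R := W x * pot (s * nrm (xi^~ x)).
Let mpot : measurable_fun setT (fun x => pot (s * nrm (xi^~ x))).
Proof. by apply: measurable_pot; apply: measurable_funM => //; exact: measurable_nrm. Qed.
Let mq : measurable_fun setT q.
Proof. exact: (measurable_funM (G_meas_measurable mC GW) mpot). Qed.
Let q0 x : (0 <= q x)%R.
Proof. by rewrite mulr_ge0 ?pot_ge0 ?W0. Qed.

Let int_q : \int[P]_x (q x)%:E <= M%:E * \int[P]_x (W x)%:E.
Proof.
have -> : M%:E * \int[P]_x (W x)%:E = \int[P]_x (W x * M)%:E.
  under [RHS]eq_integral do rewrite mulrC EFinM.
  rewrite ge0_integralZl//; [exact/measurable_EFinP/(G_meas_measurable mC GW)|].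
  by move=> x _; rewrite lee_fin.
apply: (integral_weight_le mC mpot) => //; last exact: (@measurableT _ (g_sigma_algebraType C)).
  by move=> x; exact: pot_ge0.
move=> A GA; apply: le_trans (xiM GA) _.
by rewrite integral_cst; [exact: lexx|exact (sub_measurable mC GA)].
Qed.

Let iq : P.-integrable setT (EFin \o q).
Proof.
apply/integrableP; split; first exact/measurable_EFinP.
rewrite (eq_integral (fun x => (q x)%:E)); last by move=> x _; rewrite gee0_abs ?lee_fin.
apply: le_lt_trans int_q _; rewrite lte_mul_pinfty ?lee_fin//.
have /integrableP[_] := iS.
by rewrite (eq_integral (fun x => (W x)%:E))// => x _; rewrite gee0_abs// lee_fin expR_ge0.
Qed.

(** Since [|S k| <= rad], the factor [s / rad] cancels [S k] and leaves at most
    [s |xi| <= pot (s |xi|)]; the products inherit integrability from [q]. *)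
Let iVxi k : P.-integrable setT (EFin \o (fun x => V k x * xi k x)%R).
Proof.
apply: le_integrable iq => //.
  by apply/measurable_EFinP; exact: (measurable_funM (G_meas_measurable mC (GV k)) (mxi k)).
move=> x _; rewrite /= lee_fin [leRHS]ger0_norm// /V /q.
rewrite !normrM (ger0_norm (W0 x)) -!mulrA ler_wpM2l// (gtr0_norm s0).
have r0 := rad_gt0 s0 (S^~ x).
rewrite gtr0_norm ?invr_gt0//.
apply: le_trans (pot_ge _); rewrite ler_pM2l//.
rewrite mulrA -[leRHS]mul1r; apply: ler_pM => //; last exact: (normr_coord_le (xi^~ x)).
  by rewrite mulr_ge0 ?invr_ge0 ?(ltW r0).
rewrite mulrC ler_pdivrMr// mul1r; apply: le_trans (nrm_le_rad s (S^~ x)).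
exact: (normr_coord_le (S^~ x)).
Qed.

Let bound x : (expR (s * rad s (fun k => S k x + xi k x)) <= q x + \sum_k V k x * xi k x)%R.
Proof.
apply: le_trans (expR_rad_step s0 (S^~ x) (xi^~ x)) _; rewrite lerD2l /ip mulr_sumr.
by apply: ler_sum => k _; rewrite /V /W !mulrA.
Qed.

Let isum : P.-integrable setT (fun x => \sum_k (V k x * xi k x)%:E).
Proof. by apply: integrable_sum => // k _; exact: iVxi. Qed.

Let mstep : measurable_fun setT (fun x => (expR (s * rad s (fun k => S k x + xi k x)))%:E).
Proof.
apply/measurable_EFinP; apply: measurableT_comp => //; apply: measurable_funM => //.
by apply: measurable_rad => k; exact: measurable_funD.
Qed.

Lemma integrable_expR_rad_step :
  P.-integrable setT (fun x => (expR (s * rad s (fun k => S k x + xi k x)))%:E).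
Proof.
apply: le_integrable (integrableD measurableT iq isum) => // x _.
rewrite /= sumEFin -EFinD lee_fin [leLHS]ger0_norm ?expR_ge0//.
exact: le_trans (bound x) (ler_norm _).
Qed.

Lemma integral_expR_rad_step :
  \int[P]_x (expR (s * rad s (fun k => S k x + xi k x)))%:E <=
  M%:E * \int[P]_x (expR (s * rad s (S^~ x)))%:E.
Proof.
apply: le_trans int_q.
have -> : \int[P]_x (q x)%:E = \int[P]_x ((q x)%:E + \sum_k (V k x * xi k x)%:E).
  rewrite integralD//= integral_sum// big1 ?adde0// => k _.
  exact: (integral_weight_eq0 mC (ixi k) (GV k) (iVxi k) (xi0 k)
    (@measurableT _ (g_sigma_algebraType C))).
apply: ge0_le_integral => //.
- by apply: emeasurable_funD => //; [exact/measurable_EFinP|exact: measurable_int isum].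
- by move=> x _; rewrite sumEFin -EFinD lee_fin.
Qed.

End one_step.

(** Markov's inequality for [expR (s * rad S_n)], whose expectation gains at most a factor [M] per
    round from the starting value [expR 1 <= 3]. The generators [C t] are not assumed nested;
    measurability of earlier increments for each later [C t] takes that place, so histories and
    pi-systems both qualify. *)
Lemma martingale_tail (C : nat -> set (set T)) (xi : nat -> I -> T -> R) (s M r : R) (n : nat) :
  (0 < s)%R -> (0 <= M)%R ->
  (forall t, (1 <= t <= n)%N -> C t `<=` measurable) ->
  (forall u t k, (1 <= u < t)%N -> (t <= n)%N -> G_meas <<s C t>> (xi u k)) ->
  (forall t k, (1 <= t <= n)%N -> P.-integrable setT (EFin \o xi t k)) ->
  (forall t k A, (1 <= t <= n)%N -> <<s C t>> A -> \int[P]_(x in A) (xi t k x)%:E = 0) ->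
  (forall t A, (1 <= t <= n)%N -> <<s C t>> A ->
     \int[P]_(x in A) (pot (s * nrm (xi t ^~ x)))%:E <= M%:E * P A) ->
  P [set x | (r <= nrm (fun k => \sum_(1 <= t < n.+1) xi t k x))%R] <=
    (3 * expR (- (s * r)) * M ^+ n)%:E.
Proof.
move=> s0 M0 mC Gxi ixi xi0 xiM.
pose S m k x : R := (\sum_(1 <= t < m.+1) xi t k x)%R.
have main m : (m <= n)%N -> P.-integrable setT (fun x => (expR (s * rad s (S m ^~ x)))%:E) /\
    \int[P]_x (expR (s * rad s (S m ^~ x)))%:E <= (3 * M ^+ m)%:E.
  elim: m => [|m IH] mn.
    have e1 x : expR (s * rad s (S 0%N ^~ x)) = expR 1.
      rewrite /rad /nrm big1 => [|k _]; last by rewrite /S big_geq// expr0n.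
      by rewrite sqrtr0 expr0n addr0 sqrtr_sqr gtr0_norm ?invr_gt0// mulfV// gt_eqF.
    split.
      apply: (eq_integrable _ (cst (expR 1)%:E)) => //; first by move=> x _; rewrite e1.
      by apply: finite_measure_integrable_cst.
    under eq_integral do rewrite e1.
    by rewrite integral_cst//= probability_setT mule1 expr0 mulr1 lee_fin expR1_le3.
  have [iS intS] := IH (ltnW mn).
  have SE x : S m.+1 ^~ x = fun k => (S m k x + xi m.+1 k x)%R.
    by apply/funext => k; rewrite /S big_nat_recr.
  have m1n : (1 <= m.+1 <= n)%N by [].
  have GS k : G_meas <<s C m.+1>> (S m k).
    apply/G_measP; apply: measurable_sum_range => u um.
    by apply/G_measP; exact: Gxi.
  under eq_fun do rewrite SE.
  split.
    exact: (integrable_expR_rad_step (mC _ m1n) s0 M0 GS (fun k => ixi _ k m1n) (fun A => xiM _ A m1n) iS).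
  apply: le_trans (integral_expR_rad_step (mC _ m1n) s0 M0 GS (fun k => ixi _ k m1n)
    (fun k A => xi0 _ k A m1n) (fun A => xiM _ A m1n) iS) _.
  rewrite exprS mulrCA EFinM; exact: lee_wpmul2l.
have [iS intS] := main n (leqnn n).
set f := (fun x => _) in iS; set A := [set x | _].
have mf : measurable_fun setT f by exact: measurable_int iS.
have f0 x : 0 <= f x by rewrite lee_fin expR_ge0.
have mA : measurable A.
  have mS k : measurable_fun setT (S n k).
    apply: measurable_sum_range => u un.
    by apply/measurable_EFinP; exact: measurable_int (ixi u k un).
  rewrite -[A]setTI; apply: measurable_fun_ler => //.
  exact: measurable_nrm.
have e1 : (expR (s * r))%:E * P A <= (3 * M ^+ n)%:E.
  apply: le_trans intS; rewrite -integral_cst//.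
  apply: (@le_trans _ _ (\int[P]_(x in A) f x)).
    apply: ge0_le_integral => //.
    - by move=> x _; rewrite lee_fin expR_ge0.
    - exact: measurable_funTS.
    - move=> x Ax; rewrite lee_fin ler_expR ler_pM2l//.
      by apply: le_trans Ax _; exact: nrm_le_rad.
  exact: ge0_subset_integral.
rewrite -(fineK (fin_num_measure P A mA)) -EFinM lee_fin in e1 *.
by rewrite lee_fin expRN mulrAC ler_pdivlMr ?expR_gt0// mulrC.
Qed.

End concentration.

(** * Existence of conditional probabilities *)

Section trim.
Local Open Scope ereal_scope.
Context d (T : measurableType d) (R : realType) (P : probability T R).
Variables (C : set (set T)) (mC : C `<=` measurable).
Variables (B : set T) (mB : measurable B).

(* [mC] and [mB] are arguments so that the measure structure can be inferred. *)
Definition trim of C `<=` measurable & measurable B :=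
  fun A : set (g_sigma_algebraType C) => P ((A : set T) `&` B).

Let nu := trim mC mB.

Let trim0 : nu set0 = 0. Proof. by rewrite /nu /trim set0I measure0. Qed.

Let trim_ge0 A : 0 <= nu A. Proof. exact: measure_ge0. Qed.

Let trim_sigma_additive : semi_sigma_additive nu.
Proof.
move=> F mF tF mUF; rewrite /nu /trim setI_bigcupl.
apply: measure_semi_sigma_additive.
- by move=> n; apply: measurableI => //; exact: (sub_measurable mC (mF n)).
- exact: trivIset_setIr.
- by rewrite -setI_bigcupl; apply: measurableI => //; exact: (sub_measurable mC mUF).
Qed.

HB.instance Definition _ := isMeasure.Build _ _ _ (trim mC mB)
  trim0 trim_ge0 trim_sigma_additive.

Let trim_finite : fin_num_fun (trim mC mB).
Proof.
move=> A mA; apply: fin_num_measure; apply: measurableI => //.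
exact: (sub_measurable mC mA).
Qed.

HB.instance Definition _ := Measure_isFinite.Build _ _ _ (trim mC mB) trim_finite.

End trim.

Section conditional_probability.
Local Open Scope ereal_scope.
Context d (T : measurableType d) (R : realType) (P : probability T R).
Variables (C : set (set T)) (mC : C `<=` measurable).

Lemma trim_pushforward :
  trim P mC (@measurableT _ T) = pushforward P (id : T -> g_sigma_algebraType C).
Proof. by apply/funext => A; rewrite /trim /pushforward setIT. Qed.

(* Radon-Nikodym on the sub-sigma-algebra. *)
Lemma cond_prob_exists B : measurable B ->
  exists q, cond_exp_version P <<s C>> (\1_B : T -> R) q.
Proof.
move=> mB.
have mid : measurable_fun setT (id : T -> g_sigma_algebraType C).
  by move=> _ A mA; rewrite setTI; exact: (sub_measurable mC mA).
have dom : (trim P mC mB) `<< (trim P mC (@measurableT _ T)).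
  apply/null_content_dominatesP => A mA.
  have mA' := sub_measurable mC mA.
  rewrite /= /trim setIT => A0; apply/eqP; rewrite eq_le measure_ge0 andbT -A0.
  by apply: le_measure; rewrite ?inE//; exact: measurableI.
have [f [f0 ffin intf fE]] := radon_nikodym_sigma_finite dom.
have mf : measurable_fun setT f by exact: measurable_int intf.
have ffE x : (fine (f x))%:E = f x by rewrite fineK.
have intA A : <<s C>> A -> \int[P]_(x in A) (fine (f x))%:E = P (A `&` B).
  move=> GA; transitivity (\int[trim P mC (@measurableT _ T)]_(x in (A : set (g_sigma_algebraType C))) f x).
    rewrite trim_pushforward ge0_integral_pushforward//.
      by apply: eq_integral => x _; rewrite ffE.
    exact: measurable_funTS.
  by rewrite -fE.
have mq : measurable_fun setT (fine \o f : g_sigma_algebraType C -> R).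
  exact: measurableT_comp.
exists (fine \o f); split.
- exact: integrable_indic.
- exact/G_measP.
- apply/integrableP; split.
    by apply/measurable_EFinP; apply: (G_meas_measurable mC); exact/G_measP.
  rewrite (eq_integral (fun x : T => (fine (f x))%:E)); last first.
    by move=> x _; rewrite gee0_abs// lee_fin fine_ge0.
  rewrite intA; last exact: (@measurableT _ (g_sigma_algebraType C)).
  by rewrite setTI -ge0_fin_numE// fin_num_measure.
- move=> A GA; rewrite intA// integral_indic//; last exact: (sub_measurable mC GA).
  by rewrite setIC.
Qed.

End conditional_probability.

(** * One arm under conditional independence *)

Lemma normr_indic (R : realType) (T : Type) (A : set T) x : `|\1_A x : R| = \1_A x.
Proof. by rewrite ger0_norm// indicE; case: (x \in A). Qed.

Lemma indic_le1 (R : realType) (T : Type) (A : set T) x : (\1_A x : R) <= 1.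
Proof. by rewrite indicE; case: (x \in A). Qed.

Section arm.
Local Open Scope ereal_scope.
Context d (T : measurableType d) (R : realType) (P : probability T R).
Variables (C : set (set T)) (mC : C `<=` measurable).
Notation G := <<s C>>.
Variables (D : set T) (p eta : T -> R).
Hypothesis mD : measurable D.
Hypothesis p_cond : cond_exp_version P G (\1_D : T -> R) p.
Hypothesis p0 : forall x, (0 < p x)%R.
Hypothesis meta : measurable_fun setT eta.
Hypothesis indep_arm : forall (B : set R) (q : T -> R), measurable B ->
  cond_exp_version P G (\1_(eta @^-1` B) : T -> R) q ->
  cond_exp_version P G (fun w => \1_D w * \1_(eta @^-1` B) w)%R (fun w => p w * q w)%R.

Let GT : G setT := @measurableT _ (g_sigma_algebraType C).
Let ip : P.-integrable setT (EFin \o p). Proof. by case: p_cond. Qed.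
Let Gp : G_meas G p. Proof. by case: p_cond. Qed.
Let mp : measurable_fun setT p. Proof. exact: (G_meas_measurable mC Gp). Qed.
Let mDf : measurable_fun setT (\1_D : T -> R). Proof. exact: measurable_indic. Qed.
Let p_ge0 x : (0 <= p x)%R. Proof. exact: ltW. Qed.

Lemma propensity_integral A : G A -> \int[P]_(x in A) (p x)%:E = P (A `&` D).
Proof.
move=> GA; have [_ _ _ ->//] := p_cond.
by rewrite integral_indic 1?setIC//; exact: (sub_measurable mC GA).
Qed.

Let meta_pre B : measurable B -> measurable (eta @^-1` B).
Proof. by move=> mB; rewrite -[_ @^-1` _]setTI; exact: meta. Qed.

(** Both sides equal the integral of [p q] over [A], for [q] a conditional probability of
    [eta \in B]: the left by the independence hypothesis, the right by taking out [p]. The event on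
    [eta] is made the domain so that functions of [eta] can next serve as weights. *)
Lemma arm_indep_event A B : G A -> measurable B ->
  \int[P]_(x in eta @^-1` B) (\1_D x * \1_A x)%:E = \int[P]_(x in eta @^-1` B) (p x * \1_A x)%:E.
Proof.
move=> GA mB; have mA := sub_measurable mC GA.
have mB' := meta_pre mB.
have [q qB] := cond_prob_exists P mC mB'.
have [iB Gq iq qE] := qB.
have [_ _ ipq pqE] := indep_arm mB qB.
have mI : measurable_fun setT (\1_(eta @^-1` B) : T -> R) by exact: measurable_indic.
have ipB : P.-integrable setT (EFin \o (fun x => p x * \1_(eta @^-1` B) x)%R).
  apply: le_integrable ip => //.
    by apply/measurable_EFinP; exact: measurable_funM.
  by move=> x _; rewrite /= lee_fin normrM ler_piMr// normr_indic indic_le1.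
have swap (f : T -> R) : \int[P]_(x in eta @^-1` B) (f x * \1_A x)%:E =
    \int[P]_(x in A) (f x * \1_(eta @^-1` B) x)%:E.
  rewrite integral_mkcond [RHS]integral_mkcond; apply: eq_integral => x _.
  by rewrite !epatch_indic -!EFinM mulrAC.
rewrite !swap -pqE//.
have ih : P.-integrable setT (EFin \o (fun x => q x - \1_(eta @^-1` B) x)%R).
  have := integrableB measurableT iq iB; apply: eq_integrable => // x _.
have := integral_weight_eq0 mC ih Gp _ _ GA.
have e x : (p x * (q x - \1_(eta @^-1` B) x) = p x * q x - p x * \1_(eta @^-1` B) x)%R.
  by rewrite mulrBr.
under eq_integral do rewrite e EFinB.
rewrite integralB_EFin//; last 2 first.
- exact: integrableS ipq.
- exact: integrableS ipB.
move=> h; have {}h : \int[P]_(x in A) (p x * q x)%:E - \int[P]_(x in A) (p x * \1_(eta @^-1` B) x)%:E = 0.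
  apply: h.
    have := integrableB measurableT ipq ipB; apply: eq_integrable => // x _.
    by rewrite /= e.
  move=> A' GA'; have mA' := sub_measurable mC GA'.
  under eq_integral do rewrite EFinB.
  rewrite integralB_EFin//; [|exact: integrableS iq|exact: integrableS iB].
  rewrite qE// subee//; apply: integrable_fin_num => //; exact: integrableS iB.
move/eqP: h; rewrite sube_eq ?add0e; first by move/eqP.
- by apply: integrable_fin_num => //; exact: integrableS ipq.
- by rewrite fin_num_adde_defl//; apply: integrable_fin_num => //; exact: integrableS ipB.
Qed.

(** Roles are reversed here: [g (eta x)] is the weight, and [1_D 1_A] and [p 1_A] are the integrands
    compared on events about [eta]. *)
Lemma arm_indep_fun (g : R -> R) A : measurable_fun setT g -> (forall y, 0 <= g y)%R -> G A ->
  \int[P]_(x in A) (\1_D x * g (eta x))%:E = \int[P]_(x in A) (p x * g (eta x))%:E.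
Proof.
move=> mg g0 GA; have mA := sub_measurable mC GA.
have swap (f : T -> R) : \int[P]_(x in A) (f x * g (eta x))%:E =
    \int[P]_x ((g (eta x))%:E * (f x * \1_A x)%:E).
  rewrite integral_mkcond; apply: eq_integral => x _.
  by rewrite epatch_indic -!EFinM mulrCA mulrA.
have mfA (f : T -> R) : measurable_fun setT f ->
    measurable_fun setT (fun x => (f x * \1_A x)%:E).
  by move=> mf; apply/measurable_EFinP; apply: measurable_funM => //; exact: measurable_indic.
rewrite !swap; apply: (eq_integral_weight (W := g \o eta)) => //; try exact: mfA;
  try (by move=> x; rewrite lee_fin mulr_ge0);
  try (by move=> x; exact: g0); first exact: measurableT_comp.
move=> B mB; rewrite comp_preimage; apply: arm_indep_event => //.
by rewrite -[_ @^-1` _]setTI; exact: mg.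
Qed.

(** A conditional moment bound on [eta] survives restriction to [D] with the mass of [A] inside [D],
    not of [A], on the right; summing over arms then loses no factor. *)
Lemma arm_integral_le (g : R -> R) (M : R) A :
  measurable_fun setT g -> (forall y, 0 <= g y)%R -> (0 <= M)%R ->
  (forall A', G A' -> \int[P]_(x in A') (g (eta x))%:E <= M%:E * P A') ->
  G A -> \int[P]_(x in A) (\1_D x * g (eta x))%:E <= M%:E * P (A `&` D).
Proof.
move=> mg g0 M0 gM GA; have mA := sub_measurable mC GA.
rewrite arm_indep_fun//.
have -> : M%:E * P (A `&` D) = \int[P]_(x in A) (p x * M)%:E.
  under eq_integral do rewrite mulrC EFinM.
  rewrite ge0_integralZl//; last 2 first.
  - by apply: measurable_funTS; exact/measurable_EFinP.
  - by move=> x _; rewrite lee_fin.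
  by rewrite propensity_integral.
apply: (integral_weight_le mC) => //; first exact: measurableT_comp.
move=> A' GA'; apply: le_trans (gM _ GA') _.
by rewrite integral_cst; [exact: lexx|exact: (sub_measurable mC GA')].
Qed.

Hypothesis ieta : P.-integrable setT (EFin \o eta).
Hypothesis eta0 : forall A, G A -> \int[P]_(x in A) (eta x)%:E = 0.

Let iDeta : P.-integrable setT (EFin \o (fun x => \1_D x * eta x)%R).
Proof.
apply: le_integrable ieta => //.
  by apply/measurable_EFinP; exact: measurable_funM.
by move=> x _; rewrite /= lee_fin normrM ler_piMl// normr_indic indic_le1.
Qed.

(** [p] is only a version of a conditional probability and carries no pointwise upper bound;
    integrability of [p eta] is transferred from that of [1_D eta]. *)
Let ipeta : P.-integrable setT (EFin \o (fun x => p x * eta x)%R).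
Proof.
apply/integrableP; split.
  by apply/measurable_EFinP; exact: measurable_funM.
rewrite (eq_integral (fun x => (p x * `|eta x|)%:E)); last first.
  by move=> x _; rewrite /= normrM ger0_norm.
rewrite -(@arm_indep_fun (fun y => `|y|%R))//.
have /integrableP[_] := iDeta; congr (_ < _); apply: eq_integral => x _.
by rewrite /= normrM normr_indic.
Qed.

(** [E[1_D eta | G] = E[p eta | G] = p E[eta | G] = 0]. The first identity is known for nonnegative
    functions of [eta], hence the split into positive and negative parts. *)
Lemma arm_mean0 A : G A -> \int[P]_(x in A) (\1_D x * eta x)%:E = 0.
Proof.
move=> GA; have mA := sub_measurable mC GA.
have <- : \int[P]_(x in A) (p x * eta x)%:E = 0.
  exact: (integral_weight_eq0 mC ieta Gp ipeta eta0 GA).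
pose pp (y : R) := Num.max y 0%R; pose nn (y : R) := Num.max (- y)%R 0%R.
have mpp : measurable_fun setT pp by exact: measurable_maxr.
have mnn : measurable_fun setT nn by apply: measurable_maxr => //; exact: measurable_funN.
have pp0 y : (0 <= pp y)%R by rewrite le_max lexx orbT.
have nn0 y : (0 <= nn y)%R by rewrite le_max lexx orbT.
have pnB y : (y = pp y - nn y)%R.
  by rewrite /pp /nn; case: (leP 0%R y) => y0; [rewrite max_r|rewrite max_l]; lra.
have pple y : (pp y <= `|y|)%R.
  by rewrite /pp ge_max normr_ge0 ler_norm.
have nnle y : (nn y <= `|y|)%R.
  by rewrite /nn ge_max normr_ge0 -normrN ler_norm.
have split_ (w : T -> R) : measurable_fun setT w -> (forall x, 0 <= w x)%R ->
    P.-integrable setT (EFin \o (fun x => w x * eta x)%R) ->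
    \int[P]_(x in A) (w x * eta x)%:E =
    \int[P]_(x in A) (w x * pp (eta x))%:E - \int[P]_(x in A) (w x * nn (eta x))%:E.
  move=> mw w0 iw.
  have dom (g : R -> R) : measurable_fun setT g -> (forall y, 0 <= g y)%R ->
      (forall y, g y <= `|y|)%R -> P.-integrable A (EFin \o (fun x => w x * g (eta x))%R).
    move=> mg g0 gle; apply: (@integrableS _ _ _ _ setT) => //.
    apply: le_integrable iw => //.
      by apply/measurable_EFinP; apply: measurable_funM => //; exact: measurableT_comp.
    by move=> x _; rewrite /= lee_fin !normrM ler_wpM2l// ger0_norm.
  rewrite -integralB_EFin//; [|exact: dom|exact: dom].
  by apply: eq_integral => x _; rewrite /= {1}(pnB (eta x)) mulrBr EFinB.
rewrite !split_// !arm_indep_fun//.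
Qed.

Variables (Q : T -> R) (c k : R).
Hypothesis GQ : G_meas G Q.
Hypothesis Qc : forall x, (`|Q x| <= c)%R.
Hypothesis pk : forall x, D x -> ((p x)^-1 <= k)%R.

Let c0 (x : T) : (0 <= c)%R. Proof. exact: le_trans (Qc x). Qed.
Let GQp : G_meas G (fun x => Q x / p x)%R.
Proof.
apply/G_measP; apply: measurable_funM; first exact/G_measP.
by apply: measurable_inv_pos => //; exact/G_measP.
Qed.
Let mQp : measurable_fun setT (fun x => Q x / p x)%R.
Proof. exact: (G_meas_measurable mC GQp). Qed.

Let QD x : (`|Q x / p x * \1_D x| <= `|c * k|)%R.
Proof.
rewrite indicE; have [/set_mem Dx|] := boolP (x \in D); last first.
  by move=> _; rewrite mulr0 normr0.
have k0 : (0 <= k)%R by apply: le_trans (pk Dx); rewrite invr_ge0.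
rewrite mulr1 normrM [leRHS]ger0_norm ?mulr_ge0//; last exact: (c0 x).
apply: ler_pM => //; rewrite ger0_norm ?invr_ge0//; exact: pk.
Qed.

Lemma integrable_arm_noise :
  P.-integrable setT (EFin \o (fun x => Q x / p x * (\1_D x * eta x))%R).
Proof.
have := integrableZl measurableT `|c * k|%R ieta; apply: le_integrable => //.
  by apply/measurable_EFinP; apply: measurable_funM => //; exact: measurable_funM.
move=> x _; rewrite /= lee_fin mulrA normrM [leRHS]normrM normr_id.
by rewrite ler_wpM2r.
Qed.

Lemma arm_noise_mean0 A : G A ->
  \int[P]_(x in A) (Q x / p x * (\1_D x * eta x))%:E = 0.
Proof.
exact: (integral_weight_eq0 mC iDeta GQp integrable_arm_noise arm_mean0).
Qed.

(** Expanded, the integrand is [Q / p * 1_D - Q]: the inverse propensity occurs only on [D], where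
    [k] bounds it. *)
Lemma integrable_arm_ipw :
  P.-integrable setT (EFin \o (fun x => Q x / p x * (\1_D x - p x))%R).
Proof.
apply: (@le_integrable _ _ _ _ _ measurableT _ (cst (`|c * k| + c)%:E)) => //; last 1 first.
- exact: finite_measure_integrable_cst.
- apply/measurable_EFinP; apply: measurable_funM => //; exact: measurable_funB.
- move=> x _; rewrite /= lee_fin mulrBr divfK ?gt_eqF//.
  rewrite [leRHS]ger0_norm ?addr_ge0//; last exact: (c0 x).
  by apply: le_trans (ler_normB _ _) _; apply: lerD.
Qed.

Lemma arm_ipw_mean0 A : G A ->
  \int[P]_(x in A) (Q x / p x * (\1_D x - p x))%:E = 0.
Proof.
have iD : P.-integrable setT (EFin \o (\1_D : T -> R)) by exact: integrable_indic.
apply: (integral_weight_eq0 mC _ GQp integrable_arm_ipw).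
  by have := integrableB measurableT iD ip; apply: eq_integrable.
move=> A' GA'; have mA' := sub_measurable mC GA'.
under eq_integral do rewrite EFinB.
rewrite integralB_EFin//; [|exact: integrableS iD|exact: integrableS ip].
rewrite propensity_integral// integral_indic// setIC subee//.
by rewrite fin_num_measure//; exact: measurableI.
Qed.

End arm.

(** * Independent contexts *)

Section independence.
Local Open Scope ereal_scope.
Context d (T : measurableType d) (R : realType) (P : probability T R).
Variables (E : nat -> set (set T)) (n : nat).
Hypothesis mE : forall t, (1 <= t <= n)%N -> E t `<=` measurable.
Hypothesis indepE : indep_sigmas P (fun t => <<s E t>>) [set t | (1 <= t <= n)%N].

(* A pi-system, so that Dynkin's lemma extends the product rule from [indepE]
   to the sigma-algebra it generates. *)
Definition past_inter (t : nat) : set (set T) :=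
  [set A | exists2 B : nat -> set T, (forall u, (1 <= u < t)%N -> <<s E u>> (B u))
     & A = \big[setI/setT]_(1 <= u < t) B u].

Lemma past_inter_measurable t : (1 <= t <= n)%N -> past_inter t `<=` measurable.
Proof.
move=> /andP[_ tn] _ [B EB ->]; rewrite big_nat_cond.
apply: big_ind => //; first exact: measurableI.
move=> u /[!andbT] /[dup] /andP[u1 ut] /EB; apply: sub_measurable.
by apply: mE; rewrite u1 (leq_trans (ltnW ut) tn).
Qed.

Lemma past_inter_setI t : setI_closed (past_inter t).
Proof.
move=> _ _ [B EB ->] [B' EB' ->]; exists (fun u => B u `&` B' u).
  by move=> u ut; apply: sub_setI; [exact: EB|exact: EB'].
by rewrite big_split.
Qed.

Lemma past_inter_setT t : past_inter t setT.
Proof.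
exists (fun=> setT); last by rewrite big1.
by move=> u _; exact: (@measurableT _ (g_sigma_algebraType (E u))).
Qed.

Lemma past_inter_sub u t A : (1 <= u < t)%N -> <<s E u>> A -> past_inter t A.
Proof.
move=> ut EA; exists (fun v => if v == u then A else setT).
  by move=> v _; case: eqP => [->//|_]; exact: (@measurableT _ (g_sigma_algebraType (E v))).
rewrite (bigD1_seq u) ?iota_uniq//=; last by rewrite mem_index_iota.
by rewrite eqxx big1 ?setIT// => v /negbTE ->.
Qed.

(** For fixed [B], two finite measures in [A] are compared. On the pi-system [past_inter t] they
    agree because [B] is just one more factor in the product rule of [indepE]. *)
Lemma past_present_indep t A B : (1 <= t <= n)%N ->
  <<s past_inter t>> A -> <<s E t>> B -> P (A `&` B) = P A * P B.
Proof.
move=> tn GA EB; have mB := sub_measurable (mE tn) EB.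
have PBfin : P B \is a fin_num by exact: fin_num_measure.
have r0 : (0 <= fine (P B))%R by rewrite fine_ge0.
pose m1 : {measure set T -> \bar R} := mrestr P mB.
pose m2 : {measure set T -> \bar R} := mscale (NngNum r0) P.
suff : m1 A = m2 A by rewrite /m1 /m2 /= /mrestr /mscale/= fineK// muleC.
apply: (g_sigma_algebra_measure_unique (past_inter t) _ (fun=> setT)) GA => //.
- exact: past_inter_measurable.
- by move=> _; exact: past_inter_setT.
- by rewrite bigcup_const//; exists 0%N.
- exact: past_inter_setI.
- move=> _ [A' EA' ->].
  rewrite /m1 /m2 /= /mrestr /mscale/= fineK//.
  have inI u : u \in index_iota 1 t -> (1 <= u <= n)%N.
    rewrite mem_index_iota => /andP[-> ut].
    by move/andP: tn => [_]; apply: leq_trans; exact: ltnW.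
  rewrite (indepE (s := index_iota 1 t)) ?iota_uniq//; last first.
    by move=> u ut; split; [exact: inI|apply: EA'; rewrite -mem_index_iota].
  pose A2 u := if u == t then B else A' u.
  have ne u : u \in index_iota 1 t -> A2 u = A' u.
    by rewrite mem_index_iota /A2 => /andP[_ ut]; rewrite (ltn_eqF ut).
  have t1 : (1 <= t)%N by case/andP: tn.
  have -> : \big[setI/setT]_(1 <= u < t) A' u `&` B = \big[setI/setT]_(1 <= u < t.+1) A2 u.
    rewrite big_nat_recr//= /A2 eqxx; congr (_ `&` _).
    by apply: eq_big_seq => u ut; rewrite -/(A2 u) ne.
  rewrite (indepE (s := index_iota 1 t.+1)) ?iota_uniq//; last first.
    move=> u; rewrite mem_index_iota ltnS [(u <= t)%N]leq_eqVlt => /andP[u1 /orP[/eqP ->|ut]].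
      by split => //; rewrite /A2 eqxx.
    have ui : u \in index_iota 1 t by rewrite mem_index_iota u1.
    by split; [exact: inI|rewrite ne//; apply: EA'; rewrite u1].
  rewrite big_nat_recr//= /A2 eqxx muleC; congr (_ * _).
  by apply: eq_big_seq => u ut; rewrite -/(A2 u) ne.
- move=> _; change (P (setT `&` B) < +oo).
  by rewrite setTI -ge0_fin_numE.
Qed.

Lemma past_mean0 t (W : T -> R) : (1 <= t <= n)%N ->
  G_meas <<s E t>> W -> P.-integrable setT (EFin \o W) -> \int[P]_x (W x)%:E = 0 ->
  forall A, <<s past_inter t>> A -> \int[P]_(x in A) (W x)%:E = 0.
Proof.
move=> tn GW iW W0 A GA.
have mA := sub_measurable (past_inter_measurable tn) GA.
have iA : P.-integrable setT (EFin \o (\1_A : T -> R)) by exact: integrable_indic.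
pose r := fine (P A); have rE : P A = r%:E by rewrite fineK// fin_num_measure.
have ir : P.-integrable setT (EFin \o (cst r : T -> R)) by exact: finite_measure_integrable_cst.
have iWA : P.-integrable setT (EFin \o (fun x => W x * \1_A x)%R).
  apply: le_integrable iW => //.
    apply/measurable_EFinP; apply: measurable_funM; last exact: measurable_indic.
    exact: (G_meas_measurable (mE tn) GW).
  by move=> x _; rewrite /= lee_fin normrM ler_piMr// normr_indic indic_le1.
have iWr : P.-integrable setT (EFin \o (fun x => W x * r)%R).
  by have := integrableZr measurableT r iW; apply: eq_integrable.
(* Roles are exchanged: by independence [1_A - P A] is centred on every event of round [t], and [W]
   is the weight taken out. *)
have e : \int[P]_x (W x * (\1_A x - r))%:E = 0.
  apply: (integral_weight_eq0 (mE tn) (h := fun x => (\1_A x - r)%R)) => //.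
  - by have := integrableB measurableT iA ir; apply: eq_integrable.
  - have := integrableB measurableT iWA iWr; apply: eq_integrable => // x _.
    by rewrite /= -EFinB mulrBr.
  - move=> B EB; have mB := sub_measurable (mE tn) EB.
    under eq_integral do rewrite EFinB.
    rewrite integralB_EFin//; [|exact: integrableS iA|exact: integrableS ir].
    rewrite integral_indic// integral_cst//= (past_present_indep tn GA EB) rE.
    by rewrite subee// fin_numM// fin_num_measure.
  - exact: (@measurableT _ (g_sigma_algebraType (E t))).
move: e; under eq_integral do rewrite mulrBr EFinB.
rewrite integralB_EFin//.
rewrite [X in _ - X](_ : _ = 0) ?sube0; last first.
  under eq_integral do rewrite mulrC EFinM.
  by rewrite integralZl// W0 mule0.
move=> e; rewrite -[RHS]e [LHS]integral_mkcond; apply: eq_integral => x _.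
by rewrite epatch_indic.
Qed.

End independence.

(** * Integral bounds from conditional moments *)

Section integral_bounds.
Local Open Scope ereal_scope.
Context d (T : measurableType d) (R : realType) (P : probability T R).

Lemma bounded_integrable (f : T -> R) (c : R) :
  measurable_fun setT f -> (forall x, `|f x| <= c)%R -> P.-integrable setT (EFin \o f).
Proof.
move=> mf fc; apply: (@le_integrable _ _ _ _ _ measurableT _ (cst c%:E)) => //.
- exact/measurable_EFinP.
- by move=> x _; rewrite /= lee_fin; apply: le_trans (fc x) _; exact: ler_norm.
- exact: finite_measure_integrable_cst.
Qed.

(** Jensen for the Euclidean norm, by pairing the mean with itself: [|m|^2 = E <m, V> <= |m| c],
    free of any dimension factor. *)
Lemma nrm_integral_le (I : finType) (V : I -> T -> R) (m : I -> R) (c : R) :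
  (forall k, measurable_fun setT (V k)) -> (forall x, nrm (V^~ x) <= c)%R ->
  (forall k, \int[P]_x (V k x)%:E = (m k)%:E) -> (nrm m <= c)%R.
Proof.
move=> mV Vc mE.
have iV k : P.-integrable setT (EFin \o V k).
  apply: (bounded_integrable (mV k)) => x; apply: le_trans (Vc x).
  exact: (normr_coord_le (V^~ x)).
have im k : P.-integrable setT (fun x => (m k * V k x)%:E).
  by have := integrableZl measurableT (m k) (iV k).
have e1 : (nrm m ^+ 2)%:E = \int[P]_x (ip m (V^~ x))%:E.
  rewrite sqr_nrm /ip -sumEFin.
  under [RHS]eq_integral do rewrite -sumEFin.
  rewrite integral_sum//; apply: eq_bigr => k _.
  under eq_integral do rewrite EFinM.
  rewrite (integralZl measurableT (iV k)) expr2 EFinM; congr (_ * _).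
  exact/esym/mE.
have e2 : (nrm m ^+ 2 <= nrm m * c)%R.
  rewrite -lee_fin e1.
  have -> : (nrm m * c)%:E = \int[P]_x (cst (nrm m * c)%:E) x.
    by rewrite integral_cst//= probability_setT mule1.
  apply: le_integral => //.
  - rewrite (_ : (fun x => _) = fun x => \sum_k (m k * V k x)%:E).
      by apply: integrable_sum => // k _; exact: im.
    by apply/funext => x; rewrite sumEFin.
  - exact: finite_measure_integrable_cst.
  - move=> x _; rewrite lee_fin; apply: le_trans (ip_le _ _) _.
    by rewrite ler_wpM2l ?nrm_ge0.
have [->|n0] := eqVneq (nrm m) 0%R; last first.
  by rewrite -(ler_pM2l (_ : 0 < nrm m)%R) -?expr2// lt0r n0 nrm_ge0.
(* For a zero mean, [0 <= c] remains to be shown; it is read off at a point of the space, which is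
   nonempty because it has mass one. *)
have [x _] : (setT : set T) !=set0.
  by apply/set0P; apply/eqP => T0; have := probability_setT P; rewrite T0 measure0 => /eqP; rewrite eqe eq_sym oner_eq0.
exact: le_trans (nrm_ge0 _) (Vc x).
Qed.

Lemma cond_exp_le_integral (C : set (set T)) (f : T -> R) (c : R) A :
  C `<=` measurable -> (0 <= c)%R -> cond_exp_le P <<s C>> f c -> <<s C>> A ->
  \int[P]_(x in A) (f x)%:E <= c%:E * P A.
Proof.
move=> mC c0 [g [[_ Gg ig gE] gc]] GA; have mA := sub_measurable mC GA.
have mg : measurable_fun setT g by exact: (G_meas_measurable mC Gg).
rewrite -gE// -integral_cst//.
(* The almost sure bound is applied through a comparison of nonnegative functions; [0 <= c] keeps it
   valid after truncation at 0. *)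
pose h x := Num.max (g x) 0%R.
have h0 x : (0 <= h x)%R by rewrite le_max lexx orbT.
have mh : measurable_fun setT h by exact: measurable_maxr.
have ih : P.-integrable setT (EFin \o h).
  apply: le_integrable ig => //; first exact/measurable_EFinP.
  by move=> x _; rewrite /= lee_fin ger0_norm// ge_max normr_ge0 ler_norm.
apply: (@le_trans _ _ (\int[P]_(x in A) (h x)%:E)).
  apply: le_integral => //; [exact: integrableS ig|exact: integrableS ih|].
  by move=> x _; rewrite lee_fin /h le_max lexx.
apply: ae_ge0_le_integral => //.
- by move=> x _; rewrite lee_fin.
- by apply: measurable_funTS; exact/measurable_EFinP.
- by apply: filterS gc => x gx _; rewrite lee_fin ge_max gx.
Qed.

Lemma expR_norm_integral (C : set (set T)) (eta : T -> R) (th v : R) A :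
  C `<=` measurable -> measurable_fun setT eta ->
  (forall l : R, cond_exp_le P <<s C>> (fun w => expR (l * eta w)) (expR (l ^+ 2 * v))) ->
  <<s C>> A -> (0 <= th)%R ->
  \int[P]_(x in A) (expR (th * `|eta x|))%:E <= (2 * expR (th ^+ 2 * v))%:E * P A.
Proof.
move=> mC meta sub GA th0; have mA := sub_measurable mC GA.
have mexp l : measurable_fun A (fun x => (expR (l * eta x))%:E).
  apply: measurable_funTS; apply/measurable_EFinP; apply: measurableT_comp => //.
  exact: measurable_funM.
apply: (@le_trans _ _ (\int[P]_(x in A) ((expR (th * eta x))%:E + (expR (- th * eta x))%:E))).
  apply: ge0_le_integral => //.
  - apply: measurable_funTS; apply/measurable_EFinP; apply: measurableT_comp => //.
    by apply: measurable_funM => //; exact: measurableT_comp.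
  - exact: emeasurable_funD.
  - move=> x _; rewrite -EFinD lee_fin; have [e0|e0] := leP 0%R (eta x).
      by rewrite ger0_norm// lerDl expR_ge0.
    by rewrite ltr0_norm// mulrN mulNr lerDr expR_ge0.
rewrite ge0_integralD//; try (by move=> x _; rewrite lee_fin expR_ge0).
rewrite mulr_natl mulr2n EFinD ge0_muleDl ?lee_fin ?expR_ge0//.
apply: leeD; first exact: (cond_exp_le_integral mC (expR_ge0 _) (sub th)).
by have := cond_exp_le_integral mC (expR_ge0 _) (sub (- th)%R) GA; rewrite sqrrN.
Qed.

End integral_bounds.

(** * Positive definite matrices *)

Section spectral_bound.
Import Num.Def.
Local Open Scope sesquilinear_scope.
Variable R : realType.

Definition dotv n (u v : 'cV[R]_n) : R := ip (fun j => u j 0) (fun j => v j 0).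

(** Turns the eigenvalue form of (A4) into a quadratic-form bound. [A] is diagonalised unitarily
    over [R[i]]; the diagonal entries are real and, through the characteristic polynomial, are
    eigenvalues of [A] over [R]. Both sides become weighted sums of squared moduli of the
    coordinates [w]. *)
Lemma sym_quadratic_form_ge n (A : 'M[R]_n) (c : R) :
  A^T = A -> (forall e, eigenvalue A e -> c <= e) ->
  forall v : 'cV[R]_n, c * dotv v v <= dotv v (A *m v).
Proof.
move=> AT Ac v.
pose f : {rmorphism R -> R[i]} := real_complex R.
have fr x : f x \is Num.real by apply/complex_realP; exists x.
have fC x : conjC (f x) = f x by apply/CrealP.
pose B := map_mx f A.
have Bsym : B \is symmetricmx.
  by apply/is_hermitianmxP; rewrite expr0 scale1r map_mx_id// /B map_trmx AT.
have Breal : B \is a realmx by apply/mxOverP => i j; rewrite mxE fr.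
have Bherm := realsym_hermsym Bsym Breal.
have /orthomx_spectralP := hermitian_normalmx Bherm.
have Dreal := hermitian_spectral_diag_real Bherm.
set P := spectralmx B; set D := spectral_diag B => BE.
have PU : P \is unitarymx by exact: spectral_unitarymx.
have PV : invmx P = P^t* by exact: invmx_unitary.
have Dge i : f c <= D 0 i.
  have /complex_realP[x Dx] : D 0 i \is Num.real by exact: (mxOverP Dreal).
  rewrite Dx lecR; apply: Ac; rewrite eigenvalue_root_char -(fmorph_root f) map_char_poly.
  rewrite -eigenvalue_root_char -/B; apply/eigenvalueP; exists (row i P).
    rewrite {1}BE -row_mul 2!mulmxA mulmxV ?spectral_unit// mul1mx.
    rewrite row_mul row_diag_mx -scalemxAl -rowE Dx; congr (_ *: _).
  apply/eqP => /(congr1 (fun r => r *m invmx P)); rewrite mul0mx -row_mul.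
  rewrite mulmxV ?spectral_unit// => /rowP/(_ i); rewrite !mxE eqxx => /eqP.
  by rewrite oner_eq0.
pose w := P *m map_mx f v.
have wE : w^t* = (map_mx f v)^T *m P^t*.
  rewrite /w trmx_mul map_mxM; congr (_ *m _).
  by apply/matrixP => i j; rewrite !mxE; exact: fC.
have dotE (z : 'cV[R[i]]_n) (E : 'rV[R[i]]_n) : (z^t* *m diag_mx E *m z) 0 0 = \sum_j E 0 j * `|z j 0| ^+ 2.
  rewrite mxE; apply: eq_bigr => j _; rewrite mul_mx_diag !mxE normCK; ring.
have fdot (u z : 'cV[R]_n) : f (dotv u z) = ((map_mx f u)^T *m map_mx f z) 0 0.
  by rewrite mxE /dotv /ip rmorph_sum; apply: eq_bigr => j _; rewrite !mxE rmorphM.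
have e1 : f (dotv v v) = \sum_j `|w j 0| ^+ 2.
  transitivity ((w^t* *m diag_mx (const_mx 1) *m w) 0 0).
    rewrite fdot wE diag_const_mx mulmx1 /w mulmxA -(mulmxA _ (P^t*)).
    by rewrite -PV (mulVmx (spectral_unit B)) mulmx1.
  by rewrite dotE; apply: eq_bigr => j _; rewrite mxE mul1r.
have e2 : f (dotv v (A *m v)) = \sum_j D 0 j * `|w j 0| ^+ 2.
  by rewrite -dotE fdot map_mxM -/B BE wE PV /w !mulmxA.
rewrite -lecR (_ : real_complex R _ = f c * f (dotv v v)) ?rmorphM//.
rewrite (_ : real_complex R _ = f (dotv v (A *m v)))// e1 e2 mulr_sumr.
by apply: ler_sum => j _; rewrite ler_wpM2r// exprn_ge0.
Qed.

Lemma norm2E n (v : 'cV[R]_n) : norm2 v = nrm (fun j => v j 0).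
Proof. by []. Qed.

Lemma dotvv n (v : 'cV[R]_n) : dotv v v = norm2 v ^+ 2.
Proof. by rewrite norm2E sqr_nrm; apply: eq_bigr => k _; rewrite expr2. Qed.

Lemma norm2D_le n (u v : 'cV[R]_n) : norm2 (u + v) <= norm2 u + norm2 v.
Proof.
rewrite !norm2E; apply: le_trans (nrmD_le _ _); rewrite le_eqVlt; apply/orP; left.
by apply/eqP; congr nrm; apply/funext => k; rewrite mxE.
Qed.

Lemma norm2Z n c (v : 'cV[R]_n) : norm2 (c *: v) = `|c| * norm2 v.
Proof. by rewrite !norm2E -nrmZ; congr nrm; apply/funext => k; rewrite mxE. Qed.

Lemma coercive_unitmx n (M : 'M[R]_n) mu : 0 < mu ->
  (forall v, mu * dotv v v <= dotv v (M *m v)) -> M \in unitmx.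
Proof.
move=> mu0 Mmu; rewrite -unitmx_tr -row_free_unit -kermx_eq0.
apply/eqP/row_matrixP => i; rewrite row0; set r := row i _.
have rM : r *m M^T = 0 by apply/sub_kermxP; exact: row_sub.
have := Mmu r^T; rewrite -[M in M *m _]trmxK -trmx_mul rM trmx0.
rewrite [dotv _ 0]/dotv /ip big1 => [|k _]; last by rewrite !mxE mulr0.
rewrite pmulr_rle0// dotvv => h.
have /eqP : norm2 r^T ^+ 2 == 0 by rewrite eq_le h sqr_ge0.
move=> /eqP; rewrite sqrf_eq0 => /eqP /nrm_eq0 r0.
by apply/rowP => k; have := r0 k; rewrite !mxE.
Qed.

(** For [z = M^-1 u]: [mu |z|^2 <= <z, M z> = <z, u> <= |z| |u|]. *)
Lemma norm2_invmx_le n (M : 'M[R]_n) mu (u : 'cV[R]_n) : 0 < mu ->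
  (forall v, mu * dotv v v <= dotv v (M *m v)) ->
  norm2 (invmx M *m u) <= norm2 u / mu.
Proof.
move=> mu0 Mmu; have Mu := coercive_unitmx mu0 Mmu.
set z := invmx M *m u.
have : mu * norm2 z ^+ 2 <= norm2 z * norm2 u.
  rewrite -dotvv; apply: le_trans (Mmu z) _.
  by rewrite /z mulmxA mulmxV// mul1mx; exact: ip_le.
rewrite ler_pdivlMr// expr2 mulrA [norm2 z * _]mulrC.
have [->|z0] := eqVneq (norm2 z) 0; first by rewrite mul0r nrm_ge0.
by rewrite ler_pM2r ?lt0r ?z0 ?nrm_ge0// mulrC.
Qed.

(** Cauchy-Schwarz for the pairing of [D] with [v v^T]. Passing to the Frobenius norm lets the
    vector tail bound, indexed by pairs of coordinates, control a matrix. *)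
Lemma quadratic_form_frobenius n (D : 'M[R]_n) (v : 'cV[R]_n) :
  `|dotv v (D *m v)| <= nrm (fun p => D p.1 p.2) * dotv v v.
Proof.
have -> : dotv v (D *m v) =
    ip (fun p : 'I_n * 'I_n => D p.1 p.2) (fun p => v p.1 0 * v p.2 0).
  rewrite /dotv /ip -(pair_bigA _ (fun j k => D j k * (v j 0 * v k 0)))/=.
  apply: eq_bigr => j _; rewrite mxE mulr_sumr; apply: eq_bigr => k _; ring.
apply: le_trans (normr_ip_le _ _) _.
by rewrite (nrm_outer (fun j => v j 0) (fun j => v j 0)) dotvv expr2.
Qed.

End spectral_bound.

(** * Concentration of the Gram matrix *)

Section gram.
Context {dT : measure_display} {Omega : measurableType dT} {R : realType}.
Variable P : probability Omega R.
Context {N d : nat}.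
Variables (X : 'I_N -> nat -> Omega -> 'cV[R]_d) (T : nat).
Hypothesis N0 : (0 < N)%N.
Hypothesis mX : forall i t j, (1 <= t <= T)%N -> measurable_fun setT (fun w => X i t w j 0).
Hypothesis X1 : forall i t w, (1 <= t <= T)%N -> norm2 (X i t w) <= 1.
Hypothesis Xindep : indep_sigmas P (sigma_ctx X) [set t | (1 <= t <= T)%N].

Definition ctx_gen (t : nat) : set (set Omega) :=
  [set A | exists i, coord_preimages (X i t) A].

Definition gram (t : nat) (p : 'I_d * 'I_d) (w : Omega) : R :=
  \sum_i X i t w p.1 0 * X i t w p.2 0.

Definition gram_dev (t : nat) (p : 'I_d * 'I_d) (w : Omega) : R :=
  gram t p w - N%:R * mean_gram P X t p.1 p.2.

Lemma ctx_gen_measurable t : (1 <= t <= T)%N -> ctx_gen t `<=` measurable.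
Proof.
move=> tT _ [i [j [B [mB ->]]]]; rewrite -[_ @^-1` _]setTI.
exact: (mX i j tT).
Qed.

Lemma G_meas_ctx t i j : G_meas <<s ctx_gen t>> (fun w => X i t w j 0).
Proof. by move=> B mB; apply: sub_sigma_algebra; exists i, j, B. Qed.

Lemma G_meas_gram t p : G_meas <<s ctx_gen t>> (gram t p).
Proof.
apply/G_measP; apply: measurable_sum => i; apply: measurable_funM; apply/G_measP;
exact: G_meas_ctx.
Qed.

Lemma G_meas_gram_dev t p : G_meas <<s ctx_gen t>> (gram_dev t p).
Proof.
by apply/G_measP; apply: measurable_funB => //; apply/G_measP; exact: G_meas_gram.
Qed.

Lemma nrm_gram_le t w : (1 <= t <= T)%N -> nrm (gram t ^~ w) <= N%:R.
Proof.
move=> tT; apply: le_trans (nrm_sum_le _ (fun i (p : 'I_d * 'I_d) => X i t w p.1 0 * X i t w p.2 0)) _.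
apply: (@le_trans _ _ (\sum_(i < N) 1)); last by rewrite sumr_const card_ord.
apply: ler_sum => i _.
rewrite (nrm_outer (fun j => X i t w j 0) (fun j => X i t w j 0)) -[leRHS]mulr1.
by apply: ler_pM; rewrite ?nrm_ge0//; exact: X1.
Qed.

Lemma normr_gram_le t p w : (1 <= t <= T)%N -> `|gram t p w| <= N%:R.
Proof.
by move=> tT; apply: le_trans (nrm_gram_le w tT); exact: (normr_coord_le (gram t ^~ w)).
Qed.

Lemma measurable_gram t p : (1 <= t <= T)%N -> measurable_fun setT (gram t p).
Proof. by move=> tT; apply: (G_meas_measurable (ctx_gen_measurable tT)); exact: G_meas_gram. Qed.

Lemma integrable_gram t p : (1 <= t <= T)%N -> P.-integrable setT (EFin \o gram t p).
Proof.
by move=> tT; apply: (bounded_integrable P (measurable_gram p tT)) => w; exact: normr_gram_le.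
Qed.

Lemma integral_gram t p : (1 <= t <= T)%N ->
  (\int[P]_w (gram t p w)%:E = (N%:R * mean_gram P X t p.1 p.2)%:E)%E.
Proof.
move=> tT; rewrite mxE unlock.
have ig := integrable_gram p tT.
have -> : (\int[P]_w (N%:R^-1 * \sum_(i < N) X i t w p.1 0 * X i t w p.2 0)%:E
    = (N%:R^-1)%:E * \int[P]_w (gram t p w)%:E)%E.
  exact: (integralZl measurableT ig).
have fing : (\int[P]_w (gram t p w)%:E)%E \is a fin_num by exact: integrable_fin_num.
rewrite -(fineK fing) -EFinM /= mulrA mulfV ?mul1r//.
by rewrite pnatr_eq0 -lt0n.
Qed.

Lemma integrable_gram_dev t p : (1 <= t <= T)%N -> P.-integrable setT (EFin \o gram_dev t p).
Proof.
move=> tT; have := integrableB measurableT (integrable_gram p tT)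
  (finite_measure_integrable_cst P (N%:R * mean_gram P X t p.1 p.2) measurableT).
exact: eq_integrable.
Qed.

Lemma integral_gram_dev t p : (1 <= t <= T)%N -> (\int[P]_w (gram_dev t p w)%:E = 0)%E.
Proof.
move=> tT; rewrite /gram_dev; under eq_integral do rewrite EFinB.
rewrite integralB_EFin//; [|exact: integrable_gram|exact: finite_measure_integrable_cst].
by rewrite integral_gram// integral_cst//= probability_setT mule1 subee.
Qed.

Lemma nrm_gram_dev_le t w : (1 <= t <= T)%N -> nrm (gram_dev t ^~ w) <= 2 * N%:R.
Proof.
move=> tT; apply: le_trans (nrmD_le _ (fun p => - (N%:R * mean_gram P X t p.1 p.2))) _.
have -> : nrm (fun p => - (N%:R * mean_gram P X t p.1 p.2)) =
    nrm (fun p : 'I_d * 'I_d => N%:R * mean_gram P X t p.1 p.2).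
  by rewrite /nrm; congr Num.sqrt; apply: eq_bigr => p _; rewrite sqrrN.
have := nrm_gram_le w tT.
have : nrm (fun p : 'I_d * 'I_d => N%:R * mean_gram P X t p.1 p.2) <= N%:R.
  apply: (@nrm_integral_le _ _ _ P _ (gram t)).
  - by move=> p; exact: measurable_gram.
  - by move=> w'; exact: nrm_gram_le.
  - by move=> p; exact: integral_gram.
lra.
Qed.

Lemma gram_tail n L : (1 <= n <= T)%N -> 0 < L ->
  (P [set w | (4 * Num.sqrt 2 * N%:R * Num.sqrt (n%:R * L) <=
     nrm (fun p => \sum_(1 <= t < n.+1) gram_dev t p w))%R] <= (3 * expR (- L))%:E)%E.
Proof.
move=> /andP[n1 nT] L0.
set r := 4 * _ * _ * _.
have nN0 : 0 < N%:R :> R by rewrite ltr0n.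
have nn0 : 0 < n%:R :> R by rewrite ltr0n.
have r0 : 0 < r by rewrite /r !mulr_gt0 ?sqrtr_gt0 ?mulr_gt0.
have r2 : r ^+ 2 = 32 * N%:R ^+ 2 * n%:R * L.
  rewrite /r !exprMn !sqr_sqrtr ?mulr_ge0 ?(ltW nn0) ?(ltW L0)//; ring.
(* Minimiser of [- s r + 8 N^2 n s^2], the exponent produced by increments of size [2 N] and
   [pot y <= expR (2 y^2)]. As [r^2 = 32 N^2 n L], the minimum is [- 2 L + L]; this fixes the factor
   [4 sqrt 2] of [lam]. *)
pose s := r / (16 * N%:R ^+ 2 * n%:R).
have s0 : 0 < s by rewrite divr_gt0// !mulr_gt0// exprn_gt0.
have sr : s * r = 2 * L.
  rewrite /s mulrAC -expr2 r2; field.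
  by rewrite !gt_eqF.
have s2 : 8 * N%:R ^+ 2 * s ^+ 2 * n%:R = L.
  rewrite /s exprMn exprVn r2; field.
  by rewrite !gt_eqF.
have tT t : (1 <= t <= n)%N -> (1 <= t <= T)%N.
  by move=> /andP[-> tn]; exact: leq_trans nT.
pose M := expR (8 * N%:R ^+ 2 * s ^+ 2).
have mE t : (1 <= t <= T)%N -> ctx_gen t `<=` measurable by exact: ctx_gen_measurable.
have -> : 3 * expR (- L) = 3 * expR (- (s * r)) * M ^+ n.
  rewrite -mulrA; congr (_ * _).
  by rewrite /M -expRM_natr -expRD s2 sr; congr expR; lra.
apply: (martingale_tail (C := past_inter ctx_gen)) => //.
- exact: expR_ge0.
- by move=> t tn; apply: (past_inter_measurable mE); exact: tT.
- move=> u t p ut tn B mB; apply: sub_sigma_algebra.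
  by apply: (past_inter_sub ut); exact: G_meas_gram_dev.
- by move=> t p /tT; exact: integrable_gram_dev.
- move=> t p A /tT tn; apply: (past_mean0 mE Xindep tn).
  + exact: G_meas_gram_dev.
  + exact: integrable_gram_dev.
  + exact: integral_gram_dev.
- move=> t A /tT tn GA.
  have mA := sub_measurable (past_inter_measurable mE tn) GA.
  rewrite -integral_cst//; apply: ge0_le_integral => //.
  + by move=> w _; rewrite lee_fin pot_ge0.
  + apply: measurable_funTS; apply/measurable_EFinP; apply: measurable_pot.
    apply: measurable_funM => //; apply: measurable_nrm => p.
    by apply: (G_meas_measurable (mE t tn)); exact: G_meas_gram_dev.
  + move=> w _; rewrite lee_fin; apply: (@le_trans _ _ (pot (s * (2 * N%:R)))).
      apply: pot_mono; first by rewrite mulr_ge0 ?nrm_ge0// ltW.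
      by rewrite ler_pM2l//; exact: nrm_gram_dev_le.
    apply: le_trans (pot_le_expR_sqr _) _; first by rewrite !mulr_ge0// ltW.
    by rewrite /M ler_expR; lra.
Qed.

End gram.

(** * Concentration of the doubly robust noise *)

Section noise_envelope.
Variable R : realType.
Implicit Types b sigma k : R.

(** For [k <= 1] the envelope has coefficient [(3/2) k^2 e^{9 b}] and exponent [th = 6]; multiplied
    by the moment bound [2 e^{18 sigma^2}] it gives exactly [k^2] times this constant. *)
Definition noise_const b sigma : R := 3 * expR (9 * b + 18 * sigma ^+ 2).

Lemma noise_const_gt0 b sigma : 0 < noise_const b sigma.
Proof. by rewrite mulr_gt0 ?expR_gt0. Qed.

(* For [k <= 1] expand [pot] to second order; for [1 < k] the Gaussian factor
   [k ^+ 2] in the target exponent absorbs all constants. *)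
Lemma noise_envelope b sigma k : 0 < b -> 0 < k ->
  exists al be th : R, [/\ 0 <= al, 0 <= be, 0 <= th,
    forall y : R, pot (k * (3 * b + 2 * `|y|)) <= al + be * expR (th * `|y|) &
    al + be * (2 * expR (th ^+ 2 * (sigma ^+ 2 / 2))) <= expR (noise_const b sigma * k ^+ 2)].
Proof.
move=> b0 k0; have s0 : 0 <= sigma ^+ 2 := sqr_ge0 _.
have [k1|k1] := leP k 1.
  exists 1, (3 / 2 * k ^+ 2 * expR (9 * b)), 6; split => //.
  - by rewrite mulr_ge0 ?expR_ge0// mulr_ge0 ?sqr_ge0//; lra.
  - move=> y; have z0 : 0 <= 3 * b + 2 * `|y| by have := normr_ge0 y; lra.
    have k01 : 0 <= k <= 1 by rewrite (ltW k0).
    apply: le_trans (pot_le_small k01 z0) _.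
    suff -> : expR (3 * (3 * b + 2 * `|y|)) = expR (9 * b) * expR (6 * `|y|) by rewrite mulrA.
    by rewrite -expRD; congr expR; lra.
  - apply: le_trans (expR_ge1Dx _); rewrite lerD2l le_eqVlt; apply/orP; left; apply/eqP.
    rewrite /noise_const expRD.
    have -> : 6 ^+ 2 * (sigma ^+ 2 / 2) = 18 * sigma ^+ 2 by rewrite expr2; lra.
    by field.
exists 0, (2 * expR (3 * b * k)), (2 * k); split => //.
- by rewrite mulr_ge0 ?expR_ge0 ?(ltW k0).
- move=> y; have z0 : 0 <= k * (3 * b + 2 * `|y|).
    by rewrite mulr_ge0 ?(ltW k0)//; have := normr_ge0 y; lra.
  apply: le_trans (pot_le_expR z0) _.
  suff -> : expR (k * (3 * b + 2 * `|y|)) = expR (3 * b * k) * expR (2 * k * `|y|).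
    by rewrite add0r mulrA.
  by rewrite -expRD; congr expR; ring.
- have e2 : 2 <= expR 1 :> R by have := expR_ge_twice (1 : R); lra.
  have e4 : 4 <= expR 2 :> R.
    have -> : 2 = 1 + 1 :> R by lra.
    by rewrite expRD; nra.
  rewrite add0r.
  have -> : 2 * expR (3 * b * k) * (2 * expR ((2 * k) ^+ 2 * (sigma ^+ 2 / 2))) =
      4 * expR (3 * b * k + 2 * k ^+ 2 * sigma ^+ 2).
    rewrite expRD (_ : (2 * k) ^+ 2 * (sigma ^+ 2 / 2) = 2 * k ^+ 2 * sigma ^+ 2); first by ring.
    by field.
  apply: (@le_trans _ _ (expR 2 * expR (3 * b * k + 2 * k ^+ 2 * sigma ^+ 2))).
    by rewrite ler_wpM2r ?expR_ge0.
  rewrite -expRD ler_expR.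
  have kk : k <= k ^+ 2 by rewrite expr2 ler_peMl ?ltW.
  have c1 : 3 * (1 + (9 * b + 18 * sigma ^+ 2)) <= noise_const b sigma.
    by rewrite ler_pM2l// expR_ge1Dx.
  apply: le_trans (ler_wpM2r (sqr_ge0 k) c1).
  have h1 : b * k <= b * k ^+ 2 by rewrite ler_pM2l.
  have h2 : 0 <= sigma ^+ 2 * k ^+ 2 by rewrite mulr_ge0 ?sqr_ge0.
  have h3 : 1 <= k ^+ 2 by lra.
  have h4 : 0 <= b * k by rewrite mulr_ge0 ?ltW.
  lra.
Qed.

End noise_envelope.

Section noise.
Context {dT : measure_display} {Omega : measurableType dT} {R : realType}.
Variable P : probability Omega R.
Context {N d : nat}.
Variables (X : 'I_N -> nat -> Omega -> 'cV[R]_d) (a : nat -> Omega -> 'I_N)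
          (Y : 'I_N -> nat -> Omega -> R) (beta : 'cV[R]_d) (sigma b gamma : R)
          (pi : nat -> 'I_N -> Omega -> R) (cbeta : nat -> Omega -> 'cV[R]_d) (T : nat).
Hypothesis N0 : (0 < N)%N.
Hypothesis mX : forall i t j, (1 <= t <= T)%N -> measurable_fun setT (fun w => X i t w j 0).
Hypothesis ma : forall t k, (1 <= t <= T)%N -> measurable (a t @^-1` [set k]).
Hypothesis mY : forall i t, (1 <= t <= T)%N -> measurable_fun setT (Y i t).
Hypothesis X1 : forall i t w, (1 <= t <= T)%N -> norm2 (X i t w) <= 1.
Hypothesis eta_mean : forall i t, (1 <= t <= T)%N ->
  cond_exp_version P (hist X a Y t) (eta_noise X Y beta i t) (fun _ => 0).
Hypothesis eta_sub : forall i t, (1 <= t <= T)%N -> forall lam : R,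
  cond_exp_le P (hist X a Y t) (fun w => expR (lam * eta_noise X Y beta i t w))
       (expR (lam ^+ 2 * sigma ^+ 2 / 2)).
Hypothesis eta_indep : forall i j t, (1 <= t <= T)%N -> forall (B : set R) (q : Omega -> R), measurable B ->
  cond_exp_version P (hist X a Y t) (indic (eta_noise X Y beta i t @^-1` B)) q ->
  cond_exp_version P (hist X a Y t)
       (fun w => indic (a t @^-1` [set j]) w * indic (eta_noise X Y beta i t @^-1` B) w)
       (fun w => pi t j w * q w).
Hypothesis pi_cond : forall i t, (1 <= t <= T)%N ->
  cond_exp_version P (hist X a Y t) (indic (a t @^-1` [set i])) (pi t i).
Hypothesis b0 : 0 < b.
Hypothesis mcbeta : forall t j, (1 <= t <= T)%N -> G_meas (hist X a Y t) (fun w => cbeta t w j 0).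
Hypothesis cbeta_b : forall t w, (1 <= t <= T)%N -> norm2 (cbeta t w - beta) <= b.
Hypothesis pi0 : forall i t w, (1 <= t <= T)%N -> 0 < pi t i w.
Hypothesis gammaN : (N.+1%:R)^-1 <= gamma.
Hypothesis pi_gamma : forall t w, (1 <= t <= T)%N -> gamma < pi t (a t w) w.

(* The generators in the definition of [hist], so that [hist X a Y t] is
   [<<s hist_gen t>>] by conversion. *)
Definition hist_gen (t : nat) : set (set Omega) :=
  [set A |
        (exists tau i, (1 <= tau < t)%N /\ coord_preimages (X i tau) A)
     \/ (exists tau k, (1 <= tau < t)%N /\ A = a tau @^-1` [set k])
     \/ (exists tau B, (1 <= tau < t)%N /\ measurable B /\
           A = (fun w => Y (a tau w) tau w) @^-1` B)
     \/ (exists i, coord_preimages (X i t) A)].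

Notation G t := (<<s hist_gen t>>).
Notation eta := (eta_noise X Y beta).
Notation D t i := (a t @^-1` [set i]).

Lemma xTbE (x c : 'cV[R]_d) : xTb x c = dotv x c.
Proof. by rewrite /xTb mxE /dotv /ip; apply: eq_bigr => j _; rewrite mxE. Qed.

Lemma indic_arm t i w : (\1_(D t i) w : R) = if a t w == i then 1 else 0.
Proof.
by rewrite indicE; case: eqP => [e|ne]; [rewrite mem_set//|rewrite memNset].
Qed.

Lemma measurable_played t : (1 <= t <= T)%N -> measurable_fun setT (fun w => Y (a t w) t w).
Proof.
move=> tT; rewrite (_ : (fun w => _) = fun w => \sum_i \1_(D t i) w * Y i t w).
  apply: measurable_sum => i; apply: measurable_funM; last exact: mY.
  by apply: measurable_indic; exact: ma.
apply/funext => w; rewrite (bigD1 (a t w))//= indic_arm eqxx mul1r big1 ?addr0// => i.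
by rewrite indic_arm eq_sym => /negbTE ->; rewrite mul0r.
Qed.

Lemma hist_gen_measurable t : (1 <= t <= T)%N -> hist_gen t `<=` measurable.
Proof.
move=> /andP[t1 tT].
have le u : (1 <= u < t)%N -> (1 <= u <= T)%N.
  by move=> /andP[-> ut]; exact: leq_trans (ltnW ut) tT.
move=> _ [[u [i [ut [j [B [mB ->]]]]]]|[[u [k [ut ->]]]|[[u [B [ut [mB ->]]]]|[i [j [B [mB ->]]]]]]].
- by rewrite -[_ @^-1` _]setTI; exact: (mX i j (le _ ut)).
- exact: (ma _ (le _ ut)).
- by rewrite -[_ @^-1` _]setTI; exact: (measurable_played (le _ ut)).
- by rewrite -[_ @^-1` _]setTI; apply: (mX i j) => //; rewrite t1.
Qed.

Lemma hist_gen_mono u t : (1 <= u <= t)%N -> hist_gen u `<=` hist_gen t.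
Proof.
move=> /andP[u1 ut].
have lt v : (1 <= v < u)%N -> (1 <= v < t)%N.
  by move=> /andP[-> vu]; exact: leq_trans vu ut.
move=> A [[v [i [vu h]]]|[[v [k [vu h]]]|[[v [B [vu h]]]|[i h]]]].
- by left; exists v, i; split => //; exact: lt.
- by right; left; exists v, k; split => //; exact: lt.
- by right; right; left; exists v, B; split => //; exact: lt.
(* The contexts of round [u] are current in [hist_gen u] but belong to the past in [hist_gen t] as
   soon as [u < t]. *)
- move: ut; rewrite leq_eqVlt => /orP[/eqP ut|ut].
    by right; right; right; exists i; rewrite -ut.
  by left; exists u, i; split => //; rewrite u1.
Qed.

Lemma G_meas_mono u t (f : Omega -> R) : (1 <= u <= t)%N -> G_meas (G u) f -> G_meas (G t) f.
Proof.
move=> ut Gf B mB; have := Gf _ mB; apply: sub_sigma_algebra2; exact: hist_gen_mono.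
Qed.

Lemma G_meas_X t i j : G_meas (G t) (fun w => X i t w j 0).
Proof. by move=> B mB; apply: sub_sigma_algebra; right; right; right; exists i, j, B. Qed.

Lemma G_meas_arm u t i : (1 <= u < t)%N -> G_meas (G t) (\1_(D u i) : Omega -> R).
Proof.
move=> ut; apply/G_measP; apply: (@measurable_indic _ (g_sigma_algebraType (hist_gen t))).
by apply: sub_sigma_algebra; right; left; exists u, i.
Qed.

Lemma G_meas_played u t : (1 <= u < t)%N -> G_meas (G t) (fun w => Y (a u w) u w).
Proof.
by move=> ut B mB; apply: sub_sigma_algebra; right; right; left; exists u, B.
Qed.

Definition noise t (k : 'I_d) w : R :=
  \sum_i X i t w k 0 * (YDR X a Y pi cbeta i t w - xTb (X i t w) beta).

Lemma G_meas_dot u t i (c : Omega -> 'cV[R]_d) : (1 <= u <= t)%N ->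
  (forall j, G_meas (G t) (fun w => c w j 0)) ->
  G_meas (G t) (fun w => xTb (X i u w) (c w)).
Proof.
move=> ut Gc; apply/G_measP; under eq_fun do rewrite xTbE /dotv /ip.
apply: measurable_sum => j; apply: measurable_funM; apply/G_measP; last exact: Gc.
exact (G_meas_mono ut (@G_meas_X u i j)).
Qed.

(** The strict inequality matters: [a u] and the observed reward enter the history only at the next
    round, whereas [pi u] and [cbeta u] are already measurable at round [u]. *)
Lemma G_meas_noise u t k : (1 <= u < t)%N -> (t <= T)%N -> G_meas (G t) (noise u k).
Proof.
move=> ut tT; have ult : (1 <= u <= t)%N by case/andP: ut => -> /ltnW.
have uT : (1 <= u <= T)%N by case/andP: ult => ->; move/leq_trans; exact.
apply/G_measP; apply: measurable_sum => i; apply: measurable_funM.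
  by apply/G_measP; exact (G_meas_mono ult (@G_meas_X u i k)).
have mr : measurable_fun setT ((fun w => (if a u w == i then 1 else 0) / pi u i w)
    : g_sigma_algebraType (hist_gen t) -> R).
  under eq_fun do rewrite -indic_arm.
  apply: measurable_funM; first by apply/G_measP; exact: G_meas_arm.
  apply: measurable_inv_pos => [w|]; first exact: pi0.
  by apply/G_measP; apply: (G_meas_mono ult); case: (pi_cond i uT).
apply: measurable_funB; last first.
  by apply/G_measP; apply: (G_meas_dot _ ult) => j; apply/G_measP; exact: measurable_cst.
rewrite /YDR /=; apply: measurable_funD; apply: measurable_funM => //.
- exact: measurable_funB.
- apply/G_measP; apply: (G_meas_dot _ ult) => j.
  by apply: (G_meas_mono ult); exact: mcbeta.
- by apply/G_measP; exact: G_meas_played.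
Qed.

Definition pilot_err t i w : R := xTb (X i t w) (cbeta t w - beta).

(** The doubly robust split: inverse-weighted noise, centred because [eta] is, and an
    inverse-weighted pilot error multiplied by [1_D - pi], centred because [pi] is the
    propensity. *)
Lemma YDR_err t i w : (1 <= t <= T)%N -> YDR X a Y pi cbeta i t w - xTb (X i t w) beta =
  (\1_(D t i) w * eta i t w) / pi t i w - pilot_err t i w / pi t i w * (\1_(D t i) w - pi t i w).
Proof.
move=> tT; have p0 := pi0 i w tT.
rewrite /YDR /= -indic_arm /pilot_err.
have -> : xTb (X i t w) (cbeta t w - beta) = xTb (X i t w) (cbeta t w) - xTb (X i t w) beta.
  by rewrite /xTb mulmxBr !mxE.
have -> : \1_(D t i) w / pi t i w * Y (a t w) t w = \1_(D t i) w / pi t i w * Y i t w.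
  by rewrite indic_arm; case: eqP => [->//|_]; rewrite !mul0r.
rewrite /eta_noise; field; by rewrite gt_eqF.
Qed.

Lemma pilot_err_le t i w : (1 <= t <= T)%N -> `|pilot_err t i w| <= b.
Proof.
move=> tT; rewrite /pilot_err xTbE; apply: le_trans (normr_ip_le _ _) _.
rewrite -[b]mul1r; apply: ler_pM; rewrite ?nrm_ge0//; first exact: X1.
exact: cbeta_b.
Qed.

(** From [1 / gamma <= N + 1 <= 2 N]: on the played arm the inverse propensity costs the same order
    [N] as the sum over arms. *)
Lemma inv_pi_le t w : (1 <= t <= T)%N -> (pi t (a t w) w)^-1 <= 2 * N%:R.
Proof.
move=> tT; have g0 : 0 < gamma by apply: lt_le_trans gammaN; rewrite invr_gt0.
have pg := pi_gamma w tT.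
apply: (@le_trans _ _ N.+1%:R).
  rewrite -[leRHS]invrK lef_pV2 ?posrE ?invr_gt0//; last exact: pi0.
  exact: le_trans gammaN (ltW pg).
by rewrite -natrM ler_nat mul2n -addnn -addn1 leq_add2l.
Qed.

(** For an arm not played the pseudo-reward error is the pilot error itself, at most [b]; the played
    arm adds [(eta - pilot_err) / pi], at most [2 N (|eta| + b)]. The total is
    [N b + 2 N b + 2 N |eta|]. *)
Lemma nrm_noise_le t w : (1 <= t <= T)%N ->
  nrm (noise t ^~ w) <= N%:R * (3 * b + 2 * `|eta (a t w) t w|).
Proof.
move=> tT; set i0 := a t w.
have p0 := pi0 i0 w tT.
have e : noise t ^~ w = fun k => \sum_i pilot_err t i w * X i t w k 0
    + (eta i0 t w - pilot_err t i0 w) / pi t i0 w * X i0 t w k 0.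
  apply/funext => k; rewrite /noise.
  under eq_bigr do rewrite YDR_err//.
  rewrite (bigD1 i0)//= [in RHS](bigD1 i0)//= indic_arm eqxx.
  rewrite (eq_bigr (fun i => pilot_err t i w * X i t w k 0)).
    by field; rewrite gt_eqF.
  move=> i ne; rewrite indic_arm eq_sym (negbTE ne) !mul0r sub0r.
  have pi_gt0 := pi0 i w tT; field; by rewrite gt_eqF.
rewrite e; apply: le_trans (nrmD_le _ _) _.
have h1 : nrm (fun k => \sum_i pilot_err t i w * X i t w k 0) <= N%:R * b.
  apply: le_trans (nrm_sum_le _ (fun i k => pilot_err t i w * X i t w k 0)) _.
  apply: (@le_trans _ _ (\sum_(i < N) b)); last first.
    by rewrite sumr_const card_ord mulr_natl.
  apply: ler_sum => i _; rewrite nrmZ -[leRHS]mulr1; apply: ler_pM => //.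
  - exact: nrm_ge0.
  - exact: pilot_err_le.
  - exact: X1.
have h2 : nrm (fun k => (eta i0 t w - pilot_err t i0 w) / pi t i0 w * X i0 t w k 0)
    <= (`|eta i0 t w| + b) * (2 * N%:R).
  rewrite nrmZ -[leRHS]mulr1; apply: ler_pM => //; [exact: nrm_ge0| |exact: X1].
  rewrite normrM; apply: ler_pM => //.
    by apply: le_trans (ler_normB _ _) _; rewrite lerD2l pilot_err_le.
  by rewrite ger0_norm ?invr_ge0 ?(ltW p0)// inv_pi_le.
by apply: le_trans (lerD h1 h2) _; lra.
Qed.

Lemma measurable_eta i t : (1 <= t <= T)%N -> measurable_fun setT (eta i t).
Proof.
move=> tT; have [ieta _ _ _] := eta_mean i tT.
by apply/measurable_EFinP; exact: measurable_int ieta.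
Qed.

Lemma eta_mean0 i t A : (1 <= t <= T)%N -> G t A -> (\int[P]_(w in A) (eta i t w)%:E = 0)%E.
Proof.
move=> tT GA; have [_ _ _ h] := eta_mean i tT.
by rewrite -h//= integral0.
Qed.

Let GT t : G t setT := @measurableT _ (g_sigma_algebraType (hist_gen t)).

Section arm_moments.
Variables (i : 'I_N) (t : nat) (tT : (1 <= t <= T)%N).

Let mH := hist_gen_measurable tT.
Let mD : measurable (D t i) := ma i tT.
Let p0 w : 0 < pi t i w := pi0 i w tT.
Let meta := measurable_eta i tT.
Let ieta : P.-integrable setT (EFin \o eta i t).
Proof. by case: (eta_mean i tT). Qed.
Let eta0 A (GA : G t A) := eta_mean0 i tT GA.
Let iarm B q (mB : measurable B) := @eta_indep i i t tT B q mB.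
Let pk w : D t i w -> (pi t i w)^-1 <= 2 * N%:R.
Proof. by move=> <-; exact: inv_pi_le. Qed.

Let mean0_noise Q c (GQ : G_meas (G t) Q) (Qc : forall w, `|Q w| <= c) :=
  arm_noise_mean0 mH mD (pi_cond i tT) p0 meta iarm ieta eta0 GQ Qc pk.
Let mean0_ipw Q c (GQ : G_meas (G t) Q) (Qc : forall w, `|Q w| <= c) :=
  arm_ipw_mean0 mH mD (pi_cond i tT) p0 GQ Qc pk.
Let int_noise Q c (GQ : G_meas (G t) Q) (Qc : forall w, `|Q w| <= c) :=
  integrable_arm_noise mH mD (pi_cond i tT) p0 meta ieta GQ Qc pk.
Let int_ipw Q c (GQ : G_meas (G t) Q) (Qc : forall w, `|Q w| <= c) :=
  integrable_arm_ipw mH mD (pi_cond i tT) p0 GQ Qc pk.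

Let X_le k w : `|X i t w k 0| <= 1.
Proof. by apply: le_trans (X1 i w tT); exact: (normr_coord_le (fun j => X i t w j 0)). Qed.

Definition noise_term k w : R := X i t w k 0 * (YDR X a Y pi cbeta i t w - xTb (X i t w) beta).

Let Q k w : R := X i t w k 0 * pilot_err t i w.

Let GQ k : G_meas (G t) (Q k).
Proof.
apply/G_measP; apply: measurable_funM; apply/G_measP; first exact: G_meas_X.
have tt : (1 <= t <= t)%N by rewrite leqnn andbT; case/andP: tT.
apply: (G_meas_dot _ tt) => j; apply/G_measP.
rewrite (_ : (fun w => _) = (fun w => cbeta t w j 0 - beta j 0)).
  by apply: measurable_funB => //; apply/G_measP; exact: mcbeta.
by apply/funext => w; rewrite !mxE.
Qed.

Let Q_le k w : `|Q k w| <= 1 * b.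
Proof. by rewrite /Q normrM; apply: ler_pM => //; exact: pilot_err_le. Qed.

Let noise_termE k w : noise_term k w =
  X i t w k 0 / pi t i w * (\1_(D t i) w * eta i t w) - Q k w / pi t i w * (\1_(D t i) w - pi t i w).
Proof. by rewrite /noise_term YDR_err// /Q; ring. Qed.

Lemma integrable_noise_term k : P.-integrable setT (EFin \o noise_term k).
Proof.
have := integrableB measurableT (int_noise (@G_meas_X t i k) (X_le k)) (int_ipw (GQ k) (Q_le k)).
by apply: eq_integrable => // w _; rewrite /= noise_termE.
Qed.

Lemma noise_term_mean0 k A : G t A -> (\int[P]_(w in A) (noise_term k w)%:E = 0)%E.
Proof.
move=> GA; have mA := sub_measurable mH GA.
under eq_integral do rewrite noise_termE EFinB.
rewrite integralB_EFin//; last 2 first.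
- by apply: integrableS (int_noise (@G_meas_X t i k) (X_le k)).
- by apply: integrableS (int_ipw (GQ k) (Q_le k)).
by rewrite (mean0_noise (@G_meas_X t i k) (X_le k) GA) (mean0_ipw (GQ k) (Q_le k) GA) sube0.
Qed.

Lemma arm_envelope_le (al be th : R) A : 0 <= al -> 0 <= be -> 0 <= th -> G t A ->
  (\int[P]_(w in A) (\1_(D t i) w * (al + be * expR (th * `|eta i t w|)))%:E <=
   (al + be * (2 * expR (th ^+ 2 * (sigma ^+ 2 / 2))))%:E * P (A `&` D t i))%E.
Proof.
move=> al0 be0 th0 GA.
have mexp : measurable_fun setT (fun y : R => expR (th * `|y|)).
  by apply: measurableT_comp => //; apply: measurable_funM.
apply: (arm_integral_le mH mD (pi_cond i tT) p0 meta iarm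
  (g := fun y => al + be * expR (th * `|y|))) => //.
- by apply: measurable_funD => //; exact: measurable_funM.
- by move=> y; rewrite addr_ge0 ?mulr_ge0 ?expR_ge0.
- by rewrite addr_ge0 ?mulr_ge0 ?expR_ge0.
- move=> A' GA'; have mA' := sub_measurable mH GA'.
  have mE : measurable_fun A' (fun w => (expR (th * `|eta i t w|))%:E).
    apply: measurable_funTS; apply/measurable_EFinP.
    exact: (measurableT_comp mexp meta).
  under eq_integral do rewrite EFinD EFinM.
  rewrite ge0_integralD//; try exact: measurable_funeM;
    try (by move=> w _; rewrite -EFinM lee_fin mulr_ge0 ?expR_ge0).
  rewrite integral_cst// ge0_integralZl//; try (by move=> w _; rewrite lee_fin expR_ge0).
  rewrite EFinD ge0_muleDl ?lee_fin ?mulr_ge0 ?expR_ge0//.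
  rewrite leeD2l// EFinM -muleA lee_wpmul2l//.
  apply: (expR_norm_integral mH meta _ GA' th0) => l.
  by have := eta_sub i tT l; rewrite mulrA.
Qed.

End arm_moments.

Lemma integrable_noise t k : (1 <= t <= T)%N -> P.-integrable setT (EFin \o noise t k).
Proof.
move=> tT; rewrite (_ : EFin \o _ = fun w => (\sum_i (noise_term i t k w)%:E)%E).
  by apply: integrable_sum => // i _; exact: integrable_noise_term.
by apply/funext => w; rewrite /= sumEFin.
Qed.

Lemma noise_mean0 t k A : (1 <= t <= T)%N -> G t A ->
  (\int[P]_(w in A) (noise t k w)%:E = 0)%E.
Proof.
move=> tT GA; have mA := sub_measurable (hist_gen_measurable tT) GA.
rewrite (eq_integral (fun w => (\sum_i (noise_term i t k w)%:E)%E)); last first.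
  by move=> w _; rewrite /noise sumEFin.
rewrite integral_sum//.
  by rewrite big1// => i _; exact: noise_term_mean0.
by move=> i; apply: integrableS (integrable_noise_term i tT k).
Qed.

(** Where arm [i] is played the envelope depends only on [eta i], so the one-arm bound applies; the
    events [D t i] partition the space and their contributions add up to [P A]. *)
Lemma noise_pot_le t s A : (1 <= t <= T)%N -> 0 < s -> G t A ->
  (\int[P]_(w in A) (pot (s * nrm (noise t ^~ w)))%:E <=
   (expR (noise_const b sigma * (s * N%:R) ^+ 2))%:E * P A)%E.
Proof.
move=> tT s0 GA; have mH := hist_gen_measurable tT; have mA := sub_measurable mH GA.
have nN0 : 0 < N%:R :> R by rewrite ltr0n.
have [al [be [th [al0 be0 th0 genv Menv]]]] := noise_envelope sigma b0 (mulr_gt0 s0 nN0).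
pose g y := al + be * expR (th * `|y : R|).
have g0 y : 0 <= g y by rewrite addr_ge0 ?mulr_ge0 ?expR_ge0.
have mg : measurable_fun setT g.
  apply: measurable_funD => //; apply: measurable_funM => //.
  by apply: measurableT_comp => //; apply: measurable_funM.
have mgi i : measurable_fun A (fun w => (\1_(D t i) w * g (eta i t w))%:E).
  apply: measurable_funTS; apply/measurable_EFinP; apply: measurable_funM.
    by apply: measurable_indic; exact: ma.
  exact: (measurableT_comp mg (measurable_eta i tT)).
have gi0 i w : 0 <= \1_(D t i) w * g (eta i t w) by rewrite mulr_ge0.
apply: (@le_trans _ _ (\int[P]_(w in A) \sum_i (\1_(D t i) w * g (eta i t w))%:E)%E).
  apply: ge0_le_integral => //.
  - by move=> w _; rewrite lee_fin pot_ge0.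
  - apply: measurable_funTS; apply/measurable_EFinP; apply: measurable_pot.
    apply: measurable_funM => //; apply: measurable_nrm => k.
    by apply/measurable_EFinP; exact: measurable_int (integrable_noise k tT).
  - exact: emeasurable_sum.
  - move=> w _; rewrite sumEFin lee_fin (bigD1 (a t w))//= indic_arm eqxx mul1r.
    rewrite -[leLHS]addr0; apply: lerD; last exact: sumr_ge0.
    apply: le_trans (genv _); apply: pot_mono.
      by rewrite mulr_ge0 ?nrm_ge0// ltW.
    by rewrite -mulrA ler_pM2l//; exact: nrm_noise_le.
rewrite ge0_integral_sum//; last by move=> i w _; rewrite lee_fin.
set M := expR (noise_const _ _ * _) in Menv *.
apply: (@le_trans _ _ (\sum_i M%:E * P (A `&` D t i))%E).
  apply: lee_sum => i _; apply: le_trans (arm_envelope_le i tT al0 be0 th0 GA) _.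
  by apply: lee_wpmul2r; [exact: measure_ge0|rewrite lee_fin; exact: Menv].
rewrite -ge0_sume_distrr; last by move=> i _; exact: measure_ge0.
rewrite le_eqVlt; apply/orP; left; apply/eqP; congr (_ * _)%E.
have -> : P A = (\int[P]_(w in A) \sum_i (\1_(D t i) w)%:E)%E.
  rewrite (eq_integral (cst 1%E)); first by rewrite integral_cst// mul1e.
  move=> w _; rewrite sumEFin (bigD1 (a t w))//= indic_arm eqxx big1 ?addr0// => i.
  by rewrite indic_arm eq_sym => /negbTE ->.
rewrite ge0_integral_sum//.
- by apply: eq_bigr => i _; rewrite integral_indic//; [rewrite setIC|exact: ma].
- by move=> i; apply: measurable_funTS; apply/measurable_EFinP; apply: measurable_indic; exact: ma.
Qed.

Lemma noise_tail n L : (1 <= n <= T)%N -> 0 < L ->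
  (P [set w | (2 * N%:R * Num.sqrt (n%:R * noise_const b sigma * L) <=
     nrm (fun k => \sum_(1 <= t < n.+1) noise t k w))%R] <= (3 * expR (- L))%:E)%E.
Proof.
move=> /andP[n1 nT] L0.
have K0 := noise_const_gt0 b sigma; set K := noise_const b sigma in K0 *.
set q := Num.sqrt _.
have nN0 : 0 < N%:R :> R by rewrite ltr0n.
have nn0 : 0 < n%:R :> R by rewrite ltr0n.
have nKL0 : 0 < n%:R * K * L by apply: mulr_gt0 => //; exact: mulr_gt0.
have q0 : 0 < q by rewrite sqrtr_gt0.
have q2 : q ^+ 2 = n%:R * K * L by rewrite sqr_sqrtr// ltW.
(* Minimiser of the exponent [- 2 N q s + K N^2 n s^2], whose two terms are again [- 2 L] and
   [L]. *)
pose s := q / (n%:R * K * N%:R).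
have s0 : 0 < s by apply: divr_gt0 => //; apply: mulr_gt0 => //; exact: mulr_gt0.
have sr : s * (2 * N%:R * q) = 2 * L.
  have -> : s * (2 * N%:R * q) = 2 * q ^+ 2 / (n%:R * K).
    by rewrite /s; field; rewrite !gt_eqF.
  by rewrite q2; field; rewrite !gt_eqF.
have s2 : K * (s * N%:R) ^+ 2 * n%:R = L.
  have -> : K * (s * N%:R) ^+ 2 * n%:R = q ^+ 2 / (n%:R * K).
    by rewrite /s; field; rewrite !gt_eqF.
  by rewrite q2; field; rewrite !gt_eqF.
have tT t : (1 <= t <= n)%N -> (1 <= t <= T)%N.
  by move=> /andP[-> tn]; exact: leq_trans nT.
pose M := expR (K * (s * N%:R) ^+ 2).
have -> : 3 * expR (- L) = 3 * expR (- (s * (2 * N%:R * q))) * M ^+ n.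
  rewrite -mulrA; congr (_ * _).
  by rewrite /M -expRM_natr -expRD s2 sr; congr expR; lra.
apply: (martingale_tail (C := hist_gen)) => //.
- exact: expR_ge0.
- by move=> t /tT; exact: hist_gen_measurable.
- by move=> u t k ut tn; apply: G_meas_noise => //; exact: leq_trans nT.
- by move=> t k /tT; exact: integrable_noise.
- by move=> t k A /tT; exact: noise_mean0.
- by move=> t A /tT tn; exact: noise_pot_le.
Qed.

End noise.

(** * The estimation error *)

Section ridge.
Context {R : realType} {d : nat}.
Implicit Types (u v : 'cV[R]_d).

Lemma dotvDr u v1 v2 : dotv u (v1 + v2) = dotv u v1 + dotv u v2.
Proof. by rewrite /dotv /ip -big_split; apply: eq_bigr => j _; rewrite mxE mulrDr. Qed.

Lemma dotvZr u c v : dotv u (c *: v) = c * dotv u v.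
Proof. by rewrite /dotv /ip mulr_sumr; apply: eq_bigr => j _; rewrite mxE mulrCA. Qed.

Lemma dotv_sumr (I : Type) (r : seq I) (F : I -> 'cV[R]_d) u :
  dotv u (\sum_(i <- r) F i) = \sum_(i <- r) dotv u (F i).
Proof.
elim: r => [|i r IH]; last by rewrite !big_cons dotvDr IH.
by rewrite !big_nil /dotv /ip big1// => j _; rewrite mxE mulr0.
Qed.

Lemma dotvv_ge0 v : 0 <= dotv v v. Proof. by rewrite dotvv sqr_ge0. Qed.

Lemma mul_outer_dot (x v : 'cV[R]_d) : x *m x^T *m v = xTb x v *: x.
Proof. by rewrite -mulmxA [x^T *m v]mx11_scalar mul_mx_scalar. Qed.

End ridge.

Section error_bound.
Context {dT : measure_display} {Omega : measurableType dT} {R : realType}.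
Variable P : probability Omega R.
Context {N d : nat}.
Variables (X : 'I_N -> nat -> Omega -> 'cV[R]_d) (a : nat -> Omega -> 'I_N)
          (Y : 'I_N -> nat -> Omega -> R) (beta : 'cV[R]_d) (phi : R)
          (pi : nat -> 'I_N -> Omega -> R) (cbeta : nat -> Omega -> 'cV[R]_d) (lam : nat -> R)
          (t : nat) (w : Omega) (r : R).
Hypotheses (N0 : (0 < N)%N) (t0 : (0 < t)%N) (phi0 : 0 < phi) (lam0 : 0 <= lam t).
Hypothesis beta1 : norm2 beta <= 1.
Hypothesis eig : forall u, (1 <= u <= t)%N ->
  forall e : R, eigenvalue (mean_gram P X u) e -> phi ^+ 2 <= e.
Hypothesis dev_le : nrm (fun p => \sum_(1 <= u < t.+1) gram_dev P X u p w) <= lam t.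
Hypothesis noise_le :
  nrm (fun k => \sum_(1 <= u < t.+1) noise X a Y beta pi cbeta u k w) <= r.

Let M : 'M[R]_d :=
  \sum_(1 <= u < t.+1) \sum_(i < N) (X i u w *m (X i u w)^T) + (lam t)%:M.

Let mean_coercive u v : (1 <= u <= t)%N ->
  phi ^+ 2 * dotv v v <= dotv v (mean_gram P X u *m v).
Proof.
move=> ut; apply: sym_quadratic_form_ge; last exact: eig.
apply/matrixP => j k; rewrite !mxE; congr (fine ('E_P[_])).
by apply/funext => w'; congr (_ * _); apply: eq_bigr => i _; rewrite mulrC.
Qed.

(** The deviation costs at most its Frobenius norm times [|v|^2], which the ridge term repays in
    full; what is left is the mean part, [N phi^2] per round. *)
Let gram_coercive v : t%:R * N%:R * phi ^+ 2 * dotv v v <= dotv v (M *m v).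
Proof.
pose Dev : 'M[R]_d := \matrix_(j, k) \sum_(1 <= u < t.+1) gram_dev P X u (j, k) w.
have -> : M = \sum_(1 <= u < t.+1) N%:R *: mean_gram P X u + Dev + (lam t)%:M.
  congr (_ + _); apply/matrixP => j k; rewrite [RHS]mxE [Dev _ _]mxE !summxE -big_split/=.
  apply: eq_bigr => u _; rewrite summxE mxE /gram_dev /gram/= addrC subrK.
  by apply: eq_bigr => i _; rewrite mxE big_ord1 mxE.
rewrite !mulmxDl !dotvDr mul_scalar_mx dotvZr mulmx_suml dotv_sumr.
have h1 : t%:R * N%:R * phi ^+ 2 * dotv v v <=
    \sum_(1 <= u < t.+1) dotv v (N%:R *: mean_gram P X u *m v).
  apply: (@le_trans _ _ (\sum_(1 <= u < t.+1) N%:R * (phi ^+ 2 * dotv v v))).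
    by rewrite sumr_const_nat subn1 -[leRHS]mulr_natl !mulrA.
  rewrite big_nat_cond [leRHS]big_nat_cond; apply: ler_sum => u /[!andbT] ut.
  rewrite -scalemxAl dotvZr ler_wpM2l//; apply: mean_coercive.
  by move: ut; rewrite ltnS.
have := quadratic_form_frobenius Dev v.
rewrite ler_norml => /andP[h2 _].
have h3 : nrm (fun p => Dev p.1 p.2) * dotv v v <= lam t * dotv v v.
  rewrite ler_wpM2r ?dotvv_ge0//.
  rewrite (_ : (fun p => _) = fun p => \sum_(1 <= u < t.+1) gram_dev P X u p w)//.
  by apply/funext => -[j k]; rewrite mxE.
lra.
Qed.

Lemma beta_hat_error :
  norm2 (beta_hat X a Y pi cbeta lam t w - beta) <= (r + lam t) / (t%:R * N%:R * phi ^+ 2).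
Proof.
have mu0 : 0 < t%:R * N%:R * phi ^+ 2 by rewrite !mulr_gt0 ?ltr0n// exprn_gt0.
have Mu := coercive_unitmx mu0 gram_coercive.
pose S : 'cV[R]_d := \col_k \sum_(1 <= u < t.+1) noise X a Y beta pi cbeta u k w.
have -> : beta_hat X a Y pi cbeta lam t w - beta = invmx M *m (S - lam t *: beta).
  rewrite -[beta in LHS](mulKmx Mu) -mulmxBr; congr (_ *m _).
  rewrite mulmxDl opprD addrA mul_scalar_mx; congr (_ - _).
  rewrite mulmx_suml -sumrB; apply/colP => k; rewrite summxE [RHS]mxE.
  apply: eq_bigr => u _; rewrite mulmx_suml -sumrB summxE; apply: eq_bigr => i _.
  by rewrite mul_outer_dot -scalerBl mxE mulrC.
apply: le_trans (norm2_invmx_le _ mu0 gram_coercive) _.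
rewrite ler_pM2r ?invr_gt0//; apply: le_trans (norm2D_le _ _) _; apply: lerD.
  apply: le_trans noise_le; rewrite le_eqVlt; apply/orP; left; apply/eqP.
  by rewrite norm2E; congr nrm; apply/funext => k; rewrite mxE.
rewrite -scaleNr norm2Z normrN ger0_norm// -[leRHS]mulr1.
by rewrite ler_wpM2l.
Qed.

End error_bound.

(** * Union bound over the rounds and conclusion *)

Lemma union_bound_inv_sqr (dT : measure_display) (Omega : measurableType dT) (R : realType)
  (P : probability Omega R) (B : nat -> set Omega) (c : R) (n : nat) :
  0 <= c -> (forall t, (1 <= t <= n)%N -> measurable (B t)) ->
  (forall t, (1 <= t <= n)%N -> (P (B t) <= (c / (2 * t%:R ^+ 2))%:E)%E) ->
  (P (\big[setU/set0]_(1 <= t < n.+1) B t) <= c%:E)%E.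
Proof.
move=> c0 mB PB; case: n mB PB => [|n] mB PB; first by rewrite big_geq// measure0 lee_fin.
(* The invariant is [sum_(t <= m + 1) 1 / t^2 <= 2 - 1 / (m + 1)], propagated by
   [1 / (x + 1)^2 <= 1 / x - 1 / (x + 1)]. *)
suff h m : (m <= n)%N -> measurable (\big[setU/set0]_(1 <= t < m.+2) B t) /\
    (P (\big[setU/set0]_(1 <= t < m.+2) B t) <= (c / 2 * (2 - m.+1%:R^-1))%:E)%E.
  apply: le_trans (proj2 (h n (leqnn n))) _; rewrite lee_fin.
  have : 0 <= n.+1%:R^-1 :> R by rewrite invr_ge0.
  move: (n.+1%:R^-1) => x x0; have := mulr_ge0 c0 x0; lra.
elim: m => [_|m IH mn].
  rewrite big_nat1; split; first exact: mB.
  by apply: le_trans (PB _ _) _ => //; rewrite lee_fin expr1n invr1; lra.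
have [mU PU] := IH (ltnW mn).
have mn' : (1 <= m.+2 <= n.+1)%N by [].
rewrite big_nat_recr//=; split; first by apply: measurableU => //; exact: mB.
apply: (le_trans (measureU2 P mU (mB _ mn'))).
apply: le_trans (leeD PU (PB _ mn')) _; rewrite -EFinD lee_fin.
set x := m.+1%:R : R; have -> : m.+2%:R = x + 1 by rewrite /x -natr1.
have x0 : 0 < x by rewrite ltr0n.
have -> : c / (2 * (x + 1) ^+ 2) = c / 2 * ((x + 1) ^+ 2)^-1 by rewrite invfM mulrA.
rewrite -mulrDr ler_wpM2l ?divr_ge0//.
suff : ((x + 1) ^+ 2)^-1 <= x^-1 - (x + 1)^-1 by move: (x^-1) (((x + 1) ^+ 2)^-1) ((x + 1)^-1) => A B1 C1; lra.
have -> : x^-1 - (x + 1)^-1 = (x * (x + 1))^-1.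
  by field; rewrite !gt_eqF// addr_gt0.
rewrite lef_pV2 ?posrE ?mulr_gt0 ?exprn_gt0 ?addr_gt0//.
by rewrite expr2 ler_pM2r ?addr_gt0// lerDl.
Qed.

Theorem theorem2 (R : realType) :
  exists C : R -> R -> R,
  forall (dT : measure_display) (Omega : measurableType dT) (P : probability Omega R)
    (N d T : nat)
    (X : 'I_N -> nat -> Omega -> 'cV[R]_d) (a : nat -> Omega -> 'I_N)
    (Y : 'I_N -> nat -> Omega -> R) (beta : 'cV[R]_d) (sigma phi : R)
    (pi : nat -> 'I_N -> Omega -> R) (cbeta : nat -> Omega -> 'cV[R]_d)
    (b gamma delta : R),
  (0 < N)%N ->
  (* the observed quantities are random variables *)
  (forall i t j, (1 <= t <= T)%N -> measurable_fun setT (fun w => X i t w j 0)) ->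
  (forall t k, (1 <= t <= T)%N -> measurable (a t @^-1` [set k])) ->
  (forall i t, (1 <= t <= T)%N -> measurable_fun setT (Y i t)) ->
  (* (A1) *)
  (forall i t w, (1 <= t <= T)%N -> norm2 (X i t w) <= 1) ->
  norm2 beta <= 1 ->
  (* (A2) *)
  0 <= sigma ->
  (forall i t, (1 <= t <= T)%N ->
     cond_exp_version P (hist X a Y t) (eta_noise X Y beta i t) (fun _ => 0)) ->
  (forall i t, (1 <= t <= T)%N -> forall lam : R,
     cond_exp_le P (hist X a Y t) (fun w => expR (lam * eta_noise X Y beta i t w))
       (expR (lam ^+ 2 * sigma ^+ 2 / 2))) ->
  (* the distribution of eta_i(t) does not depend on a_t (conditionally on H_t) *)
  (forall i j t, (1 <= t <= T)%N -> forall (B : set R) (q : Omega -> R), measurable B ->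
     cond_exp_version P (hist X a Y t) (indic (eta_noise X Y beta i t @^-1` B)) q ->
     cond_exp_version P (hist X a Y t)
       (fun w => indic (a t @^-1` [set j]) w * indic (eta_noise X Y beta i t @^-1` B) w)
       (fun w => pi t j w * q w)) ->
  (* (A3) *)
  indep_sigmas P (sigma_ctx X) [set t | (1 <= t <= T)%N] ->
  (* (A4) *)
  0 < phi ->
  (forall t, (1 <= t <= T)%N -> forall e : R, eigenvalue (mean_gram P X t) e -> phi ^+ 2 <= e) ->
  (* pi_i(t) = P(a_t = i | H_t) *)
  (forall i t, (1 <= t <= T)%N ->
     cond_exp_version P (hist X a Y t) (indic (a t @^-1` [set i])) (pi t i)) ->
  (* the pilot estimator *)
  0 < b ->
  (forall t j, (1 <= t <= T)%N -> G_meas (hist X a Y t) (fun w => cbeta t w j 0)) ->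
  (forall t w, (1 <= t <= T)%N -> norm2 (cbeta t w - beta) <= b) ->
  (* positivity of the propensities *)
  (forall i t w, (1 <= t <= T)%N -> 0 < pi t i w) ->
  (N.+1%:R)^-1 <= gamma -> gamma < (N%:R)^-1 ->
  (forall t w, (1 <= t <= T)%N -> gamma < pi t (a t w) w) ->
  0 < delta < 1 ->
  let lam := fun t : nat =>
    4 * Num.sqrt 2 * N%:R * Num.sqrt (t%:R * ln (12 * t%:R ^+ 2 / delta)) in
  exists2 E : set Omega, measurable E /\ ((1 - delta)%:E <= P E)%E &
    forall w, E w -> forall t, (1 <= t <= T)%N ->
      norm2 (beta_hat X a Y pi cbeta lam t w - beta)
        <= C b sigma / (phi ^+ 2 * Num.sqrt t%:R) * Num.sqrt (ln (12 * t%:R ^+ 2 / delta)).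
Proof.
(* With [K = noise_const b sigma], [r + lam = (2 sqrt K + 4 sqrt 2) N sqrt (t L)]; dividing by
   [t N phi^2] removes [N] and leaves [1 / sqrt t]. *)
exists (fun b sigma => 2 * Num.sqrt (noise_const b sigma) + 4 * Num.sqrt 2).
move=> dT Omega P N d T X a Y beta sigma phi pi cbeta b gamma delta N0 mX ma mY X1 beta1 _.
move=> eta_mean eta_sub eta_indep Xindep phi0 eig pi_cond b0 mcbeta cbeta_b pi0 gammaN _.
move=> pi_gamma /andP[delta0 delta1] lam.
pose L (t : nat) : R := ln (12 * t%:R ^+ 2 / delta).
pose K := noise_const b sigma.
pose r t := 2 * N%:R * Num.sqrt (t%:R * K * L t).
have lamE t : lam t = 4 * Num.sqrt 2 * N%:R * Num.sqrt (t%:R * L t) by [].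
have argL t : (1 <= t)%N -> 1 < 12 * t%:R ^+ 2 / delta.
  move=> t1; rewrite ltr_pdivlMr// mul1r (lt_le_trans delta1)//.
  have : 1 <= t%:R ^+ 2 :> R by rewrite exprn_ege1// ler1n.
  lra.
have L0 t : (1 <= t)%N -> 0 < L t by move=> /argL /ln_gt0.
have expL t : (1 <= t)%N -> expR (- L t) = delta / (12 * t%:R ^+ 2).
  by move=> t1; rewrite expRN lnK ?invf_div// posrE (lt_trans _ (argL t t1)).
pose B1 t : set Omega := [set w | lam t <=
  nrm (fun p => \sum_(1 <= u < t.+1) gram_dev P X u p w)].
pose B2 t : set Omega := [set w | r t <=
  nrm (fun k => \sum_(1 <= u < t.+1) noise X a Y beta pi cbeta u k w)].
have sub_range t u : (1 <= t <= T)%N -> (1 <= u < t.+1)%N -> (1 <= u <= T)%N.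
  by move=> /andP[_ tT] /andP[-> ut]; exact: leq_trans tT.
have mB1 t : (1 <= t <= T)%N -> measurable (B1 t).
  move=> tT; rewrite -[B1 t]setTI; apply: measurable_fun_ler => //.
  apply: measurable_nrm => p; apply: measurable_sum_range => u /(sub_range _ _ tT) uT.
  by apply/measurable_EFinP; exact: measurable_int (integrable_gram_dev P mX X1 p uT).
have mB2 t : (1 <= t <= T)%N -> measurable (B2 t).
  move=> tT; rewrite -[B2 t]setTI; apply: measurable_fun_ler => //.
  apply: measurable_nrm => k; apply: measurable_sum_range => u /(sub_range _ _ tT) uT.
  apply/measurable_EFinP; apply: measurable_int (_ : P.-integrable setT _).
  exact: (integrable_noise N0 mX ma mY X1 eta_mean pi_cond mcbeta cbeta_b pi0 gammaN pi_gamma k uT).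
have PB t : (1 <= t <= T)%N -> (P (B1 t `|` B2 t) <= (delta / (2 * t%:R ^+ 2))%:E)%E.
  move=> tT; have t1 : (1 <= t)%N by case/andP: tT.
  apply: (le_trans (measureU2 P (mB1 _ tT) (mB2 _ tT))).
  have -> : delta / (2 * t%:R ^+ 2) = 3 * expR (- L t) + 3 * expR (- L t).
    by rewrite expL//; field; rewrite pnatr_eq0 -lt0n.
  rewrite EFinD; apply: leeD.
    exact: (gram_tail N0 mX X1 Xindep tT (L0 _ t1)).
  exact: (noise_tail N0 mX ma mY X1 eta_mean eta_sub eta_indep pi_cond b0 mcbeta cbeta_b
    pi0 gammaN pi_gamma tT (L0 _ t1)).
pose Bad := \big[setU/set0]_(1 <= t < T.+1) (B1 t `|` B2 t).
have mBad : measurable Bad.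
  rewrite /Bad big_nat_cond; apply: big_ind => //; first exact: measurableU.
  by move=> t /andP[/andP[t1 tT] _]; apply: measurableU; [apply: mB1|apply: mB2]; rewrite t1.
exists (~` Bad).
  split; first exact: measurableC.
  rewrite probability_setC// EFinB leeB//.
  by apply: union_bound_inv_sqr; [exact: ltW| |exact: PB] => t tT;
    apply: measurableU; [exact: mB1|exact: mB2].
move=> w nBad t tT; have t1 : (1 <= t)%N by case/andP: tT.
have [nB1 nB2] : ~ B1 t w /\ ~ B2 t w.
  apply/not_orP => Bw; apply: nBad; rewrite /Bad (bigD1_seq t) ?iota_uniq ?mem_index_iota//=.
  by left.
have Lt := L0 t t1.
have nN0 : 0 < N%:R :> R by rewrite ltr0n.
have nt0 : 0 < t%:R :> R by rewrite ltr0n.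
have lam0 : 0 <= lam t by rewrite lamE !mulr_ge0 ?sqrtr_ge0.
have dev_le : nrm (fun p => \sum_(1 <= u < t.+1) gram_dev P X u p w) <= lam t.
  by rewrite leNgt; apply/negP => /ltW; exact: nB1.
have noise_le : nrm (fun k => \sum_(1 <= u < t.+1) noise X a Y beta pi cbeta u k w) <= r t.
  by rewrite leNgt; apply/negP => /ltW; exact: nB2.
have eigt u : (1 <= u <= t)%N -> forall e : R, eigenvalue (mean_gram P X u) e -> phi ^+ 2 <= e.
  by move=> ut; apply: eig; exact: sub_range tT ut.
apply: le_trans (beta_hat_error N0 t1 phi0 lam0 beta1 eigt dev_le noise_le) _.
have K0 : 0 < K := noise_const_gt0 b sigma.
have st : t%:R = Num.sqrt t%:R ^+ 2 :> R by rewrite sqr_sqrtr// ltW.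
have st0 : 0 < Num.sqrt t%:R :> R by rewrite sqrtr_gt0.
rewrite le_eqVlt; apply/orP; left; apply/eqP.
rewrite lamE /r !sqrtrM ?mulr_ge0 ?(ltW nt0) ?(ltW K0)// -/K -/(L t).
move: st st0; set q := Num.sqrt t%:R => st st0; rewrite st; field.
by rewrite !gt_eqF.
Qed.
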